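(* Let $t \ge 0$ and $n \ge 3$ be integers, let $G$ be a graph, and let $E_1,\ldots,E_{3n-3+t}$ be (possibly empty) sets of edges of $G$ such that the union of any $t+1$ of them contains a matching of size $n$. Then there is a rainbow matching of size $n$, i.e. distinct indices $i_1,\ldots,i_n$ and edges $f_j \in E_{i_j}$ such that $\{f_1,\ldots,f_n\}$ is a matching of size $n$. *)

(* Defs.v *)
From HB Require Import structures.
From mathcomp Require Import all_boot.
From mathcomp Require Import finmap.
From mathcomp Require Import boolp classical_sets.

Set Implicit Arguments.
Unset Strict Implicit.
Unset Printing Implicit Defensive.

Local Open Scope fset_scope.
Local Open Scope classical_set_scope.

(* Simple graphs, finite or infinite. *)
Record sgraph := SGraph {
  vertex :> choiceType;
  adj : vertex -> vertex -> Prop;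
  adj_sym : forall x y, adj x y -> adj y x;
  adj_irrefl : forall x, ~ adj x x
}.

Definition edges (G : sgraph) : set {fset G} :=
  [set e | exists x y : G, adj x y /\ e = [fset x; y]%fset].

Definition matching (G : sgraph) (M : {fset {fset G}}) : Prop :=
  [set` M] `<=` @edges G /\
  (forall e f : {fset G}, e \in M -> f \in M -> e != f -> [disjoint e & f]%fset).

Definition has_matching (G : sgraph) (F : set {fset G}) (n : nat) : Prop :=
  exists M : {fset {fset G}},
    [/\ matching M, #|` M| = n & [set` M] `<=` F].

(* Distinct indices may carry equal sets E i, so a rainbow matching consists of
   the edges f j together with an injective choice c of their indices. *)
Definition has_rainbow_matching (G : sgraph) (N : nat)
    (E : 'I_N -> set {fset G}) (n : nat) : Prop :=
  exists (c : 'I_n -> 'I_N) (f : 'I_n -> {fset G}),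
    [/\ injective c,
        forall j : 'I_n, E (c j) (f j),
        matching [fset f j | j in 'I_n]%fset
      & #|` [fset f j | j in 'I_n]%fset | = n].

(* Main.v *)
Require Import Defs.
From mathcomp Require Import all_boot perm.
From mathcomp Require Import zify.

Set Implicit Arguments.
Unset Strict Implicit.
Unset Printing Implicit Defensive.

(* Let [M] be a maximum rainbow matching, with [k < n] edges.  Add edges in unused
   colours one at a time, each making a new vertex missable by a maximum matching;
   Gallai-Edmonds theory provides such an edge as long as the unused colours admit
   an augmentation, and there are only [2k] vertices to make missable.  If some
   step gains two vertices, a spare colour augments.  Otherwise we end with a
   rainbow graph of exactly [3k] edges with factor-critical components, which is
   built by [k] successive mergings of three components by a triangle of edges.
   Undoing the last merging, the three freed colours must form a properly
   3-edge-coloured [K_4] on four components, or there would be a larger rainbow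
   matching.  Since [n >= 3], two mergings can be undone, and the two resulting
   [K_4] structures on six components always contain a rainbow perfect matching,
   a contradiction. *)

(** * Involutions and alternating orbits *)

(** The constant [3n - 3] is a budget: the [k <= n - 1] edges of the matching and one further edge
    for each of the [2k] vertices it covers. The edges are collected in a rainbow graph, not in a
    matching: every matching inside such a graph is again rainbow, hence of size at most [k], so the
    theory of ordinary graphs applies. While fewer than [3n - 3] colours are spent, more than [t]
    are left and they contain a matching of size [n]. With one colour more in total, this count
    alone would finish; with [3n - 3 + t] it can come out even, which forces [k = n - 1] and leaves
    no slack in any step. The structural half of the proof treats only this extremal case. The two
    mergings to be undone need [2(n - 1) >= 4] covered vertices. Their triangles may overlap, one
    using as a corner the component that the other has produced; the fourth corner of its [K_4] then
    replaces that corner. *)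

Section Involutions.

Variable T : finType.
Implicit Types (f g h : {ffun T -> T}) (S : {set T}) (x y v w : T).

Definition fixpts f := [set x | f x == x].
Definition nfix f := #|fixpts f|.

Lemma involution_parity f S : involutive f -> (forall x, x \in S -> f x \in S) ->
  odd #|S| = odd #|S :&: fixpts f|.
Proof.
move=> invf; elim: {S}_.+1 {-2}S (ltnSn #|S|) => // m IH S leSm clS.
have [/eqP E|[x]] := set_0Vmem (S :\: fixpts f).
  by move: E; rewrite setD_eq0 => /setIidPl ->.
rewrite !inE => /andP[fxx xS].
set S' := S :\ x :\ f x.
have fxS : f x \in S :\ x by rewrite !inE fxx clS.
have cS : #|S| = #|S'|.+2.
  by rewrite (cardsD1 x S) xS (cardsD1 (f x) (S :\ x)) fxS.
have -> : S :&: fixpts f = S' :&: fixpts f.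
  apply/setP=> y; rewrite !inE; case: (eqVneq y x) => [->|_]; first by rewrite (negbTE fxx) !andbF.
  by case: (eqVneq y (f x)) => [->|_] //; rewrite invf eq_sym (negbTE fxx) !andbF.
rewrite -IH; first by rewrite cS /= negbK.
  by lia.
move=> y; rewrite !inE => /and3P[yfx yx yS].
rewrite clS // andbT (inj_eq (inv_inj invf)) yx /=.
by apply: contra yfx => /eqP<-; rewrite invf.
Qed.

Lemma nfix_parity f : involutive f -> odd (nfix f) = odd #|T|.
Proof. by move=> invf; rewrite -cardsT (@involution_parity f setT) // setTI. Qed.

Definition switch S f g : {ffun T -> T} := [ffun x => if x \in S then g x else f x].

Lemma card_switch S f g :
  nfix (switch S f g) + #|S :&: fixpts f| = nfix f + #|S :&: fixpts g|.
Proof.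
rewrite /nfix -(cardsID S (fixpts (switch S f g))) -(cardsID S (fixpts f)).
have -> : fixpts (switch S f g) :&: S = S :&: fixpts g.
  by apply/setP=> x; rewrite !inE ffunE; case: (x \in S); rewrite ?andbF ?andbT.
have -> : fixpts (switch S f g) :\: S = fixpts f :\: S.
  by apply/setP=> x; rewrite !inE ffunE; case: (x \in S).
by rewrite (setIC (fixpts f)); lia.
Qed.

(** [S] is the component of [v] in the union of two matchings: a path starting at [v], as [f] misses
    it. Its other end is missed by [g] in the first case, where [w = v] is possible, and by [f] in
    the second. *)
Lemma alternating_orbit f g v : involutive f -> involutive g -> f v = v ->
  exists S : {set T}, [/\ v \in S, forall x, (f x \in S) = (x \in S),
    forall x, (g x \in S) = (x \in S)
    & (exists w, S :&: fixpts f = [set v] /\ S :&: fixpts g = [set w]) \/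
      (exists w, [/\ w != v, S :&: fixpts f = [set v; w] & S :&: fixpts g = set0])].
Proof.
move=> invf invg fv.
pose p := f \o g.
have injp : injective p by apply: inj_comp; apply: inv_inj.
have injX j : injective (iter j p) by elim: j => // j IH a b /= /injp /IH.
pose L := order p v; pose X i := iter i p v.
have XL : X L = v by rewrite /X iter_order.
have Lgt0 : 0 < L by apply: order_gt0.
(* On the cycle of [p] through [v], [f] is the reflection [i -> L - i] and [g] the reflection
   [i -> L - 1 - i]; the parity of [L] decides where their fixed points lie. *)
have fX i : i <= L -> f (X i) = X (L - i).
  move=> leiL; have pf y : p (f (p y)) = f y by rewrite /p /= invf invg.
  have H j : iter j p (f (X j)) = v by elim: j => [|j IH]; rewrite ?fv // iterSr /X iterS pf.
  have : iter i p (f (X i)) = iter i p (X (L - i)).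
    by rewrite H /X -iterD subnKC // -/(X L) XL.
  exact: injX.
have gX i : i < L -> g (X i) = X (L - i.+1).
  by move=> ltiL; rewrite -fX // /X iterS /p /= invf.
have Xinj i j : i < L -> j < L -> X i = X j -> i = j.
  move=> li lj E.
  have /uniqP := orbit_uniq p v => /(_ v i j).
  rewrite /orbit !inE !size_traject => /(_ li lj); apply.
  by rewrite !nth_traject.
pose S := [set x in orbit p v].
have inS x : x \in S -> exists2 i, i < L & x = X i.
  by rewrite inE => /trajectP[i li ->]; exists i.
have Sin i : X i \in S.
  by rewrite inE -fconnect_orbit; apply: fconnect_iter.
have SI h : involutive h -> (forall x, x \in S -> h x \in S) -> forall x, (h x \in S) = (x \in S).
  by move=> invh cl x; apply/idP/idP=> [/cl|/cl //]; rewrite invh.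
have X0 : X 0 = v by [].
exists S; split.
- exact: (Sin 0).
- by apply: SI => // x /inS[i li ->]; rewrite fX ?(ltnW li) // Sin.
- by apply: SI => // x /inS[i li ->]; rewrite gX // Sin.
have inF h x : (x \in fixpts h) = (h x == x) by rewrite inE.
have [oL|oL] := boolP (odd L).
  left; exists (X L./2); split; apply/setP=> x; rewrite in_setI in_set1 inF; apply/andP/eqP.
  + case=> /inS[i li ->]; rewrite fX ?(ltnW li) // => /eqP.
    by case: i li => [|i] li // /Xinj E; have := E _ li; lia.
  + by move=> ->; rewrite (Sin 0) fv.
  + case=> /inS[i li ->]; rewrite gX // => /eqP.
    by move=> /Xinj E; congr X; have := E _ li; lia.
  + move=> ->; rewrite Sin gX; last by lia.
    by split=> //; apply/eqP; congr X; lia.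
right; exists (X L./2).
have L2 : L./2 < L by lia.
have L20 : 0 < L./2 by case: (L) oL Lgt0 => [|[|m]] //=; lia.
split.
- by apply/eqP; rewrite -X0 => /Xinj E; have := E L2 Lgt0; lia.
- apply/setP=> x; rewrite in_setI in_set2 inF; apply/andP/orP.
  + case=> /inS[i li ->]; rewrite fX ?(ltnW li) // => /eqP.
    case: i li => [|i] li; first by left.
    by move=> /Xinj E; right; apply/eqP; congr X; have := E _ li; lia.
  + case=> /eqP ->; first by rewrite (Sin 0) fv.
    by rewrite Sin fX ?(ltnW L2) //; split=> //; apply/eqP; congr X; lia.
- apply/setP=> x; rewrite in_setI in_set0 inF; apply/negP=> /andP[].
  move=> /inS[i li ->]; rewrite gX // => /eqP /Xinj E.
  by have := E _ li; lia.
Qed.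

(** The enumeration order singles out one end of each matched pair, so for an involution the
    cardinality is the number of matching edges. *)
Definition lower f := [set x | enum_rank x < enum_rank (f x)].

Lemma lowerP f x : involutive f -> f x != x -> (x \in lower f) || (f x \in lower f).
Proof.
move=> invf fx; rewrite !inE invf -neq_ltn; apply: contraNneq fx => /ord_inj/enum_rank_inj E.
by rewrite -E.
Qed.

Lemma card_lower f : involutive f -> 2 * #|lower f| + nfix f = #|T|.
Proof.
move=> invf.
have d1 : lower f :&: f @: lower f = set0.
  apply/setP=> x; rewrite in_setI in_set0; apply/negP=> /andP[xl /imsetP[y yl E]].
  by move: xl yl; rewrite E !inE invf => /ltnW; rewrite leqNgt => /negbTE->.
have d2 : (lower f :|: f @: lower f) :&: fixpts f = set0.
  apply/setP=> x; rewrite in_setI in_set0; apply/negP=> /andP[+ fx].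
  have {}fx : f x = x by apply/eqP; move: fx; rewrite inE.
  case/setUP=> [|/imsetP[y + E]]; rewrite inE; first by rewrite fx ltnn.
  by rewrite -E -fx E invf ltnn.
have E : (lower f :|: f @: lower f) :|: fixpts f = setT.
  apply/setP=> x; rewrite in_setT !in_setU [x \in fixpts f]inE.
  case: eqVneq => [_|fx]; first by rewrite orbT.
  case/orP: (lowerP invf fx) => [->//|fl].
  have -> : x \in f @: lower f by apply/imsetP; exists (f x).
  by rewrite orbT.
rewrite -cardsT -E cardsU d2 cards0 subn0 cardsU d1 cards0 subn0 card_imset; last exact: inv_inj.
by rewrite mul2n addnn.
Qed.

End Involutions.

(** * Gallai-Edmonds theory *)

Section Matchings.

Variable T : finType.
Implicit Types (R Q : rel T) (f g h : {ffun T -> T}) (S : {set T}).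
Implicit Types (a u v w x y z : T) (d : nat).

Let memE (A B : {set T}) (E : A = B) z : (z \in A) = (z \in B).
Proof. by rewrite E. Qed.

(* A matching is encoded as an involution whose fixed points are the unmatched
   vertices; fewer fixed points means more edges. *)
Definition mtch R f := [forall x, (f (f x) == x) && ((f x == x) || R x (f x))].

Lemma mtchP R f :
  reflect (involutive f /\ forall x, f x != x -> R x (f x)) (mtch R f).
Proof.
apply: (iffP forallP) => [H|[H1 H2] x].
  split=> x; have /andP[/eqP // _] := H x.
  by case/orP=> [/eqP->|//]; rewrite eqxx.
by rewrite H1 eqxx /= -implyNb; apply/implyP/H2.
Qed.

Lemma mtch_inv R f : mtch R f -> involutive f.
Proof. by case/mtchP. Qed.

Lemma mtch_rel R f x : mtch R f -> f x != x -> R x (f x).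
Proof. by case/mtchP=> _; apply. Qed.

Lemma sub_mtch R Q f : subrel R Q -> mtch R f -> mtch Q f.
Proof. by move=> sRQ /mtchP[H1 H2]; apply/mtchP; split=> // x /H2/sRQ. Qed.

Lemma mtch_switch R S f g : mtch R f -> mtch R g ->
  (forall x, (f x \in S) = (x \in S)) -> (forall x, (g x \in S) = (x \in S)) ->
  mtch R (switch S f g).
Proof.
move=> /mtchP[f1 f2] /mtchP[g1 g2] fS gS; apply/mtchP; split=> x; rewrite !ffunE.
  by case: (boolP (x \in S)) => xS; rewrite ?fS ?gS ?(negbTE xS) ?xS ?f1 ?g1.
by case: ifP => xS; [apply: g2 | apply: f2].
Qed.

Definition link f x y : {ffun T -> T} :=
  [ffun z => if z == x then y else if z == y then x else f z].

Lemma mtch_link R f x y : mtch R f -> R x y -> R y x ->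
  f x = x -> f y = y -> mtch R (link f x y).
Proof.
move=> /mtchP[f1 f2] Rxy Ryx fx fy; apply/mtchP; split=> z; rewrite !ffunE.
  case: (eqVneq z x) => [->|zx]; first by rewrite eqxx; case: eqP.
  case: (eqVneq z y) => [->|zy]; first by rewrite eqxx.
  have E t : f t = t -> (f z == t) = (z == t) by move=> ft; rewrite -{1}ft (inj_eq (inv_inj f1)).
  by rewrite !E // (negbTE zx) (negbTE zy) f1.
case: (eqVneq z x) => [-> //|zx].
by case: (eqVneq z y) => [-> //|zy]; apply: f2.
Qed.

Lemma fixpts_link f x y : x != y -> fixpts (link f x y) = fixpts f :\ x :\ y.
Proof.
move=> xy; apply/setP=> z; rewrite !inE !ffunE.
case: (eqVneq z x) => [->|zx]; first by rewrite eq_sym (negbTE xy) andbF.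
by case: (eqVneq z y) => [->|zy] //; rewrite (negbTE xy).
Qed.

Lemma nfix_link f x y : f x = x -> f y = y -> x != y ->
  (nfix (link f x y)).+2 = nfix f.
Proof.
move=> fx fy xy; rewrite /nfix fixpts_link // (cardsD1 x (fixpts f)).
by rewrite (cardsD1 y (_ :\ x)) !inE fx fy eqxx (eq_sym y) xy eqxx.
Qed.

Definition unlink f x : {ffun T -> T} :=
  [ffun z => if (z == x) || (z == f x) then z else f z].

Definition del R a : rel T := [rel x y | [&& R x y, x != a & y != a]].

Lemma sub_del R a : subrel (del R a) R.
Proof. by move=> x y /and3P[]. Qed.

Lemma del_sym R a : symmetric R -> symmetric (del R a).
Proof. by move=> sR x y; rewrite /del /= sR; congr andb; rewrite andbC. Qed.

Lemma mtch_unlink R f x : mtch R f -> mtch (del R x) (unlink f x).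
Proof.
move=> /mtchP[f1 f2]; apply/mtchP.
have E z : (f z == x) = (z == f x) by rewrite -{1}(f1 x) (inj_eq (inv_inj f1)).
split=> z; rewrite !ffunE.
  case: (boolP ((z == x) || (z == f x))) => [->//|nz].
  by rewrite E (inj_eq (inv_inj f1)) orbC (negbTE nz) f1.
case: (boolP ((z == x) || (z == f x))) => [_|]; first by rewrite eqxx.
rewrite negb_or => /andP[zx zfx] fz; apply/and3P; split=> //; first exact: f2.
by rewrite E.
Qed.

Lemma fixpts_unlink f x : fixpts (unlink f x) = x |: (f x |: fixpts f).
Proof.
apply/setP=> z; rewrite !inE ffunE orbA.
by case: ifP => //; rewrite eqxx.
Qed.

Lemma nfix_unlink f x : involutive f -> f x != x -> nfix (unlink f x) = (nfix f).+2.
Proof.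
move=> f1 fx; rewrite /nfix fixpts_unlink !cardsU1 !inE (eq_sym x) (negbTE fx) /= f1.
by rewrite (eq_sym x) (negbTE fx).
Qed.

(** * Missable vertices and Gallai's lemma *)

Definition minfix R d := forall f, mtch R f -> d <= nfix f.

Definition both R d x y := [exists f, [&& mtch R f, nfix f == d, f x == x & f y == y]].

(** When [minfix R d] holds and [d] is attained, this is the set [D] of the Gallai-Edmonds
    decomposition. *)
Definition missable R d := [set x | both R d x x].

Lemma bothP R d x y :
  reflect (exists f, [/\ mtch R f, nfix f = d, f x = x & f y = y]) (both R d x y).
Proof.
apply: (iffP existsP) => -[f]; first by case/and4P=> m /eqP ? /eqP ? /eqP ?; exists f.
by case=> m H1 H2 H3; exists f; rewrite m H1 H2 H3 !eqxx.
Qed.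

Lemma missableP R d x :
  reflect (exists f, [/\ mtch R f, nfix f = d & f x = x]) (x \in missable R d).
Proof.
rewrite inE; apply: (iffP (bothP R d x x)); first by case=> f [? ? ? _]; exists f.
by case=> f [? ? ?]; exists f.
Qed.

Lemma in_missable R d f x : mtch R f -> nfix f = d -> f x = x -> x \in missable R d.
Proof. by move=> ? ? ?; apply/missableP; exists f. Qed.

(* Gallai's lemma: among missable vertices, being missed together by no maximum
   matching is transitive. *)
Lemma both_split R d u v w : minfix R d -> u != w -> both R d u w ->
  v \in missable R d -> both R d u v || both R d v w.
Proof.
move=> mR uw /bothP[f [mf nf fu fw]] /missableP[g [mg ng gv]].
have [S [vS gS fS [[t [E1 E2]]|[t [_ E1 E2]]]]] :=
  alternating_orbit (mtch_inv mg) (mtch_inv mf) gv.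
- have mh := mtch_switch mf mg fS gS.
  have nh : nfix (switch S f g) = d.
    by have := card_switch S f g; rewrite E1 E2 !cards1 -nf; lia.
  have hv : switch S f g v = v by rewrite ffunE vS.
  have hz z : f z = z -> z != t -> switch S f g z = z.
    move=> fz zt; rewrite ffunE; case: ifP => // zS.
    by have := memE E2 z; rewrite !inE zS fz eqxx (negbTE zt).
  case: (eqVneq u t) => [ut|ut]; apply/orP.
    right; apply/bothP; exists (switch S f g); split=> //.
    by apply: hz => //; rewrite -ut eq_sym.
  by left; apply/bothP; exists (switch S f g); split=> //; apply: hz.
- have := mR _ (mtch_switch mg mf gS fS).
  have := card_switch S g f; rewrite E1 E2 cards0.
  by have : 0 < #|[set v; t]| by [rewrite cards2]; lia.
Qed.

Lemma adj_not_both R d x y : symmetric R -> minfix R d -> R x y -> both R d x y -> x = y.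
Proof.
move=> sR mR Rxy /bothP[f [mf nf fx fy]]; apply/eqP/negPn/negP=> xy.
have Ryx : R y x by rewrite sR.
have := mR _ (mtch_link mf Rxy Ryx fx fy).
by have := nfix_link fx fy xy; lia.
Qed.

Definition within R (D : {set T}) : rel T := [rel x y | [&& R x y, x \in D & y \in D]].

Lemma within_sym R D : symmetric R -> symmetric (within R D).
Proof. by move=> sR x y; rewrite /within /= sR; congr andb; rewrite andbC. Qed.

Lemma connect_sym_within R (D : {set T}) : symmetric R ->
  connect_sym (within R D).
Proof. by move=> sR; apply: sym_connect_sym; apply: within_sym. Qed.

(** Along a path of missable vertices, [both_split] shrinks a pair missed together either to an
    edge, which could be added to the matching, or to the ends of a shorter path. *)
Lemma connect_both R d x y : symmetric R -> minfix R d ->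
  connect (within R (missable R d)) x y -> both R d x y -> x = y.
Proof.
move=> sR mR /connectP[p]; elim: p x => [|v p IH] x /=; first by [].
case/andP=> /and3P[Rxv xD vD] pp ey bxy; apply/eqP/negPn/negP=> xy.
case/orP: (both_split mR xy bxy vD) => [b|b].
  by have e := adj_not_both sR mR Rxv b; move: xy; rewrite e (IH _ pp ey) ?eqxx // -e.
have e := IH _ pp ey b; move: xy; rewrite -e in bxy *.
by rewrite (adj_not_both sR mR Rxv bxy) eqxx.
Qed.

(* The stability lemma of Gallai and Edmonds; the deleted vertex [a] stays in the
   vertex type as an isolated vertex, hence becomes missable. *)
Lemma del_missable R d a x0 : symmetric R -> minfix R d ->
  a \notin missable R d -> x0 \in missable R d -> R x0 a ->
  minfix (del R a) d.+2 /\ missable (del R a) d.+2 = a |: missable R d.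
Proof.
move=> sR mR aD x0D Rx0a.
have fa g : mtch (del R a) g -> g a = a.
  by move=> mg; apply/eqP/negPn/negP=> /(mtch_rel mg)/and3P[_]; rewrite eqxx.
have dR g : mtch (del R a) g -> mtch R g by apply: sub_mtch; apply: sub_del.
have [h [mh nh hx0]] := missableP _ _ _ x0D.
split.
  move=> g mg; have ng := mR _ (dR _ mg).
  have : nfix g != d by apply: contraNneq aD => /(in_missable (dR _ mg)); apply; apply: fa.
  (* Only [d + 1] is left to exclude, and parity does it. *)
  have := nfix_parity (mtch_inv mh); rewrite nh -(nfix_parity (mtch_inv mg)).
  by case: (nfix g =P d.+1) => [->|] /=; [case: (odd d) | lia].
apply/setP=> x; apply/idP/setU1P=> [|[->|]].
- case/missableP=> g [mg ng gx]; case: (eqVneq x a) => [|xa]; first by left.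
  right; have mg' := dR _ mg.
  (* If the alternating path from [x] ends in [a], switching [h] along it frees [x] and [a], and the
     edge from [x0] to [a] restores a maximum matching. Any other end missed by [g] would make [a]
     missable. *)
  have [S [xS gS hS [[t [E1 E2]]|[t [tx E1 E2]]]]] :=
    alternating_orbit (mtch_inv mg) (mtch_inv mh) gx.
    apply: (in_missable (mtch_switch mh mg' hS gS)); last by rewrite ffunE xS.
    by have := card_switch S h g; rewrite E1 E2 !cards1 nh !addn1 => -[].
  have xt2 : #|[set x; t]| = 2 by rewrite cards2 eq_sym tx.
  have x0S : x0 \notin S.
    by apply/negP=> x0S; have := memE E2 x0; rewrite !inE x0S hx0 eqxx.
  case: (eqVneq t a) => [ta|ta].
    have aS : a \in S by have := memE E1 a; rewrite !inE ta eqxx orbT => /andP[].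
    pose k := switch S h g.
    have nk : nfix k = d.+2 by have := card_switch S h g; rewrite E1 E2 xt2 cards0 nh addn0 addn2.
    have kx0 : k x0 = x0 by rewrite ffunE (negbTE x0S).
    have ka : k a = a by rewrite ffunE aS fa.
    have x0a : x0 != a by apply: contraNneq x0S => ->.
    have Rax0 : R a x0 by rewrite sR.
    apply: (in_missable (mtch_link (mtch_switch mh mg' hS gS) Rx0a Rax0 kx0 ka)).
      by case: (etrans (nfix_link kx0 ka x0a) nk).
    rewrite ffunE (negbTE xa); case: eqP => [e|_]; first by move: x0S; rewrite -e xS.
    by rewrite ffunE xS.
  have aS : a \notin S.
    apply/negP=> aS; have := memE E1 a; rewrite !inE aS fa // eqxx.
    by rewrite eq_sym (negbTE xa) eq_sym (negbTE ta).
  case/negP: aD; apply: (in_missable (mtch_switch mg' mh gS hS)).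
    by have := card_switch S g h; rewrite E1 E2 xt2 cards0 ng addn0 addn2 => -[].
  by rewrite ffunE (negbTE aS) fa.
- have ha : h a != a by apply: contraNneq aD; apply: in_missable.
  apply: (in_missable (mtch_unlink a mh)); first by rewrite nfix_unlink ?nh //; apply: mtch_inv mh.
  by rewrite ffunE eqxx.
- case/missableP=> g [mg ng gx].
  have ga : g a != a by apply: contraNneq aD; apply: in_missable.
  apply: (in_missable (mtch_unlink a mg)); first by rewrite nfix_unlink ?ng //; apply: mtch_inv mg.
  by rewrite ffunE gx if_same.
Qed.

(** Deleting [a] and freeing its mate gives a maximum matching of the rest, whose missable vertices
    are known from [del_missable]. *)
Lemma mate_missable R d a x0 f : symmetric R -> minfix R d ->
  a \notin missable R d -> x0 \in missable R d -> R x0 a ->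
  mtch R f -> nfix f = d -> f a \in missable R d.
Proof.
move=> sR mR aD x0D Rx0a mf nf.
have fa : f a != a by apply: contraNneq aD; apply: in_missable.
have [_ E] := del_missable sR mR aD x0D Rx0a.
have : f a \in missable (del R a) d.+2.
  apply: (in_missable (mtch_unlink a mf)); first by rewrite nfix_unlink ?nf //; apply: mtch_inv mf.
  by rewrite ffunE eqxx orbT.
by rewrite E !inE (negbTE fa).
Qed.

(** * The Gallai-Edmonds barrier and exits from missable components *)

Definition barrier R d := [set a | (a \notin missable R d) && [exists x in missable R d, R x a]].

Lemma in_barrier R d a :
  (a \in barrier R d) = (a \notin missable R d) && [exists x in missable R d, R x a].
Proof. by rewrite in_set. Qed.

(* A maximum matching leaves each component of the missable set exactly once:
   through an unmatched vertex or through an edge to the barrier. *)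
Definition exit (D : {set T}) f x := (f x == x) || (f x \notin D).

Lemma card_exits (D : {set T}) f :
  #|[set x in D | exit D f x]| = #|fixpts f :&: D| + #|[set x in D | f x \notin D]|.
Proof.
have -> : [set x in D | exit D f x] = (fixpts f :&: D) :|: [set x in D | f x \notin D].
  by apply/setP=> x; rewrite !in_set /exit; case: (x \in D); rewrite ?andbF ?andbT.
rewrite cardsU; suff -> : (fixpts f :&: D) :&: [set x in D | f x \notin D] = set0.
  by rewrite cards0 subn0.
apply/setP=> x; rewrite !in_set; apply/negP=> /andP[/andP[/eqP fx xD]].
by rewrite fx xD.
Qed.

(** Induction on the barrier: deleting a barrier vertex [a] turns an exit through [a] into an
    unmatched vertex and, by the stability lemma, adds only [a] to the missable set. Once the
    barrier is empty, all exits are unmatched and [connect_both] applies. *)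
Lemma exit_unique R d f x y : symmetric R -> minfix R d -> mtch R f -> nfix f = d ->
  connect (within R (missable R d)) x y -> x \in missable R d -> y \in missable R d ->
  exit (missable R d) f x -> exit (missable R d) f y -> x = y.
Proof.
move: {2}(#|_|.+1) (ltnSn #|barrier R d|) => m.
elim: m => // m IH in R d f * => ltm sR mR mf nf cxy xD yD ex ey.
have [B0|[a aB]] := set_0Vmem (barrier R d).
  have fixE z : z \in missable R d -> exit (missable R d) f z -> f z = z.
    move=> zD; case/orP=> [/eqP //|fzD]; apply/eqP/negPn/negP=> fz.
    suff : f z \in barrier R d by rewrite B0 inE.
    by rewrite in_barrier fzD; apply/exists_inP; exists z => //; apply: mtch_rel mf fz.
  apply: (connect_both sR mR cxy); apply/bothP; exists f; split=> //; exact: fixE.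
move: (aB); rewrite in_barrier => /andP[aD /exists_inP[x0 x0D Rx0a]].
have [mR' E] := del_missable sR mR aD x0D Rx0a.
have fa : f a != a by apply: contraNneq aD; apply: in_missable.
have neqa z : z \in missable R d -> z != a by move=> zD; apply: contraNneq aD => <-.
have xa := neqa _ xD; have ya := neqa _ yD.
have ex' z : z != a -> exit (missable R d) f z -> exit (a |: missable R d) (unlink f a) z.
  move=> za; rewrite /exit ffunE in_setU1 (negbTE za) /=.
  case: (eqVneq z (f a)) => [_|zfa]; first by rewrite eqxx.
  case/orP=> [->//|fzD]; apply/orP; right.
  rewrite negb_or fzD andbT.
  by rewrite -(inj_eq (inv_inj (mtch_inv mf))) (mtch_inv mf).
apply: (IH (del R a) d.+2 (unlink f a)); rewrite ?E ?in_setU1 ?xD ?yD ?orbT //.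
- rewrite -ltnS; apply: leq_trans ltm; rewrite ltnS; apply: proper_card; apply/properP; split.
    apply/subsetP=> z; rewrite !in_barrier E in_setU1 => /andP[/norP[za zD]].
    case/exists_inP=> z' z'D /and3P[Rz'z z'a _]; rewrite zD /=.
    apply/exists_inP; exists z' => //.
    by move: z'D; rewrite in_setU1 (negbTE z'a).
  by exists a => //; rewrite in_barrier E setU11.
- exact: del_sym.
- exact: mtch_unlink.
- by rewrite nfix_unlink ?nf //; apply: mtch_inv mf.
- apply: connect_sub cxy => u v /and3P[Ruv uD vD]; apply: connect1.
  by rewrite /within /del /= Ruv !in_setU1 uD vD !orbT (neqa _ uD) (neqa _ vD).
- exact: ex'.
- exact: ex'.
Qed.

Lemma connect_within R (D : {set T}) x y : x \in D -> connect (within R D) x y -> y \in D.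
Proof.
move=> xD /connectP[p]; elim: p x xD => [|v p IH] x xD /=; first by move=> _ ->.
by case/andP=> /and3P[_ _ vD]; apply: IH.
Qed.

Lemma exit_exists R d g x : symmetric R -> minfix R d -> involutive g ->
  (forall z, z \in missable R d -> g z != z -> g z \in missable R d ->
     connect (within R (missable R d)) z (g z)) ->
  x \in missable R d ->
  exists r, [/\ r \in missable R d, connect (within R (missable R d)) x r
    & exit (missable R d) g r].
Proof.
move=> sR mR invg gcon xD.
have [h [mh nh hx]] := missableP _ _ _ xD.
set D := missable R d in gcon xD *.
pose K := [set z | connect (within R D) x z].
have KD z : z \in K -> z \in D by rewrite inE; apply: connect_within.
have clK (k : {ffun T -> T}) : (forall z, z \in D -> k z != z -> k z \in D -> connect (within R D) z (k z)) ->
    (forall z, z \in K -> exit D k z -> k z = z) -> forall z, z \in K -> k z \in K.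
  move=> kcon kex z zK; have [e|ne] := boolP (exit D k z); first by rewrite kex.
  move: ne; rewrite negb_or negbK => /andP[kz kzD].
  by rewrite inE; apply: connect_trans (kcon _ (KD _ zK) kz kzD); move: zK; rewrite inE.
have oddK : odd #|K|.
  have exx z : z \in K -> exit D h z -> z = x.
    move=> zK ez; apply/esym; apply: (exit_unique sR mR mh nh) => //; last 2 first.
    - exact: KD.
    - by rewrite /exit hx eqxx.
    - by move: zK; rewrite inE.
  rewrite (involution_parity (mtch_inv mh)).
    suff -> : K :&: fixpts h = [set x] by rewrite cards1.
    apply/setP=> z; rewrite in_setI in_set1 [z \in fixpts h]inE; apply/andP/eqP=> [[zK hz]|->].
      by apply: exx; rewrite // /exit hz.
    by rewrite hx inE connect0.
  apply: clK => [z zD hz hzD|z zK /(exx _ zK) -> //].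
  by apply: connect1; rewrite /within /= zD hzD (mtch_rel mh).
have [/existsP[r /andP[rK er]]|/existsPn nex] := boolP [exists r, (r \in K) && exit D g r].
  by exists r; split=> //; [apply: KD | move: rK; rewrite inE].
have nexK z : z \in K -> ~~ exit D g z by move=> zK; have := nex z; rewrite zK.
move: oddK; rewrite (involution_parity invg).
  suff -> : K :&: fixpts g = set0 by rewrite cards0.
  apply/setP=> z; rewrite in_setI in_set0 [z \in fixpts g]inE; apply/negP=> /andP[zK gz].
  by have := nexK z zK; rewrite /exit gz.
by apply: clK => // z zK ez; have := nexK z zK; rewrite ez.
Qed.

Definition addedge R x y : rel T :=
  [rel u v | [|| R u v, (u == x) && (v == y) | (u == y) && (v == x)]].

Lemma addedge_sym R x y : symmetric R -> symmetric (addedge R x y).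
Proof. by move=> sR u v; rewrite /addedge /= sR orbCA orbC -orbA; do 2!congr orb; rewrite andbC. Qed.

Lemma sub_addedge R x y : subrel R (addedge R x y).
Proof. by move=> u v Ruv; rewrite /addedge /= Ruv. Qed.

Lemma sub_missable R Q d : subrel R Q -> missable R d \subset missable Q d.
Proof.
move=> sRQ; apply/subsetP=> x /missableP[f [mf nf fx]].
exact: in_missable (sub_mtch sRQ mf) nf fx.
Qed.

(* An edge that changes neither the matching number nor the missable set neither
   merges two missable components nor leaves the Gallai-Edmonds barrier, so the
   barrier still bounds matchings after adding all such edges at once. *)
Lemma enlarge R Q d g : symmetric R -> symmetric Q -> minfix R d ->
  (exists2 f, mtch R f & nfix f = d) ->
  (forall x y, Q x y -> x != y ->
     minfix (addedge R x y) d /\ missable (addedge R x y) d = missable R d) ->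
  mtch [rel x y | R x y || Q x y] g -> d <= #|fixpts g :&: missable R d|.
Proof.
move=> sR sQ mR [f mf nf] HQ mg.
set D := missable R d in HQ *.
have fixD x : f x = x -> x \in D by apply: in_missable.
have fcon z : z \in D -> f z != z -> f z \in D -> connect (within R D) z (f z).
  by move=> zD fz fzD; apply: connect1; rewrite /within /= zD fzD (mtch_rel mf).
have fmate a x : a \notin D -> x \in D -> R x a -> f a \in D.
  by move=> aD xD Rxa; apply: (mate_missable sR mR aD xD Rxa).
(* Once [xy] is added, the exits of [f] from the components of [x] and [y] are exits from one
   component, so they coincide; hence the components were equal before. *)
have QDD x y : Q x y -> x != y -> x \in D -> y \in D -> connect (within R D) x y.
  move=> Qxy xy xD yD; have [mR' ED] := HQ _ _ Qxy xy.
  have [rx [rxD cx ex]] := exit_exists sR mR (mtch_inv mf) fcon xD.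
  have [ry [ryD cy ey]] := exit_exists sR mR (mtch_inv mf) fcon yD.
  have sub u v : connect (within R D) u v -> connect (within (addedge R x y) D) u v.
    apply: connect_sub => {}u {}v /and3P[Ruv uD vD]; apply: connect1.
    by rewrite /within /= uD vD sub_addedge.
  have E : rx = ry.
    apply: (exit_unique (addedge_sym x y sR) mR' (sub_mtch (@sub_addedge R x y) mf) nf); rewrite ?ED //.
    apply: connect_trans (sub _ _ cy); apply: (@connect_trans _ _ x).
      by rewrite (connect_sym_within _ (addedge_sym x y sR)); apply: sub.
    by apply: connect1; rewrite /within /addedge /= xD yD !eqxx orbT.
  apply: connect_trans cx _; rewrite E (connect_sym_within _ sR); exact: cy.
(* Once [xy] is added, [y] is a barrier vertex, so its mate under [f] is missable, and the matching
   edge lies in [R]. *)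
have QDN x y : Q x y -> x \in D -> y \notin D -> exists2 z, z \in D & R z y.
  move=> Qxy xD yD; have xy : x != y by apply: contraNneq yD => <-.
  have [mR' ED] := HQ _ _ Qxy xy.
  have fy : f y != y by apply: contraNneq yD => /fixD.
  exists (f y); last by rewrite sR; apply: mtch_rel.
  rewrite -ED; apply: (mate_missable (addedge_sym x y sR) mR' (x0 := x)); rewrite ?ED //.
    by rewrite /addedge /= !eqxx orbT.
  exact: sub_mtch (@sub_addedge R x y) mf.
have gcon z : z \in D -> g z != z -> g z \in D -> connect (within R D) z (g z).
  move=> zD gz gzD; case/orP: (mtch_rel mg gz) => [Rz|Qz].
    by apply: connect1; rewrite /within /= Rz zD.
  by apply: QDD => //; rewrite eq_sym.
pose B := barrier R d.
pose exits (h : {ffun T -> T}) := [set x in D | exit D h x].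
pose outs (h : {ffun T -> T}) := [set x in D | h x \notin D].
have gout x : x \in outs g -> g x \in B.
  rewrite inE => /andP[xD gxD]; rewrite in_barrier gxD; apply/exists_inP.
  have gx : g x != x by apply: contraNneq gxD => ->.
  case/orP: (mtch_rel mg gx) => [Rx|Qx]; first by exists x.
  by have [z zD Rz] := QDN _ _ Qx xD gxD; exists z.
(* [f] leaves each missable component exactly once, [g] at least once. At most [#|B|] exits of [g]
   and at least [#|B|] exits of [f] lead to the barrier; the others are unmatched vertices. *)
have le1 : #|outs g| <= #|B|.
  rewrite -(card_imset _ (inv_inj (mtch_inv mg))); apply: subset_leq_card.
  by apply/subsetP=> _ /imsetP[x xo ->]; apply: gout.
have le2 : #|B| <= #|outs f|.
  rewrite -(card_imset _ (inv_inj (mtch_inv mf))); apply: subset_leq_card.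
  apply/subsetP=> _ /imsetP[a aB ->]; move: aB; rewrite in_barrier => /andP[aD /exists_inP[x xD Rxa]].
  by rewrite inE (fmate _ _ aD xD Rxa) (mtch_inv mf).
have le3 : #|exits f| <= #|exits g|.
  have pick x : {r | x \in D -> [/\ r \in D, connect (within R D) x r & exit D g r]}.
    have [xD|_] := boolP (x \in D); last by exists x.
    pose P r := [&& r \in D, connect (within R D) x r & exit D g r].
    case: (pickP P) => [r /and3P[? ? ?]|nP]; first by exists r.
    exists x => _; have [r [r1 r2 r3]] := exit_exists sR mR (mtch_inv mg) gcon xD.
    by have := nP r; rewrite /P r1 r2 r3.
  rewrite -(@card_in_imset _ _ (fun x => sval (pick x))).
    apply: subset_leq_card; apply/subsetP=> _ /imsetP[x xe ->]; have xD : x \in D by move: xe; rewrite inE => /andP[].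
    by have [rD _ er] := svalP (pick x) xD; rewrite [_ \in exits g]inE rD.
  move=> x y; rewrite in_set => /andP[xD ex]; rewrite in_set => /andP[yD ey] E.
  apply: (exit_unique sR mR mf nf) => //.
  have [_ cx _] := svalP (pick x) xD; have [_ cy _] := svalP (pick y) yD.
  by apply: connect_trans cx _; rewrite E (connect_sym_within _ sR).
have cards := card_exits D.
have fixf : fixpts f :&: D = fixpts f.
  by apply/setIidPl/subsetP=> x; rewrite in_set => /eqP/fixD.
move: le3; rewrite !cards fixf -/(nfix f) nf => le3.
rewrite -(leq_add2r #|outs f|); apply: leq_trans le3 _; rewrite leq_add2l.
exact: leq_trans le1 le2.
Qed.

End Matchings.

(** * Graphs with factor-critical components *)

Lemma uniq_map_injective (aT rT : eqType) (f : aT -> rT) (s : seq aT) :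
  uniq (map f s) -> {in s &, injective f}.
Proof.
elim: s => //= a s IH /andP[fa us] x y; rewrite !inE.
case/predU1P=> [->|xs] /predU1P[->|ys] //; last exact: IH.
- by move=> E; rewrite E map_f in fa.
- by move=> E; rewrite -E map_f in fa.
Qed.

Section Full.

Variable T : finType.
Implicit Types (R Q : rel T) (f g h : {ffun T -> T}) (S : {set T}).
Implicit Types (a u v w x y z : T) (d : nat).

(* Equivalently, every component is factor-critical and [d] counts the components. *)
Definition full R d := minfix R d /\ missable R d = setT.

Lemma root_eqP R x y : symmetric R -> reflect (root R x = root R y) (connect R x y).
Proof.
move=> sR; rewrite -(root_connect (sym_connect_sym sR)); exact: eqP.
Qed.

Lemma root_edge R x y : symmetric R -> R x y -> root R x = root R y.
Proof. by move=> sR Rxy; apply/root_eqP => //; apply: connect1. Qed.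

Lemma connect_full R x y : connect (within R setT) x y = connect R x y.
Proof. by apply: eq_connect => u v; rewrite /within /= !inE !andbT. Qed.

Section FullTheory.

Variables (R : rel T) (d : nat).
Hypotheses (sR : symmetric R) (fR : full R d).

Lemma full_unique f x y : mtch R f -> nfix f = d -> f x = x -> f y = y ->
  root R x = root R y -> x = y.
Proof.
move=> mf nf fx fy E; have [mR ET] := fR.
apply: (connect_both sR mR); first by rewrite ET connect_full; apply/root_eqP.
by apply/bothP; exists f.
Qed.

Lemma full_odd g x : involutive g ->
  (forall z, root R z = root R x -> root R (g z) = root R x) ->
  exists2 z, root R z = root R x & g z = z.
Proof.
move=> invg cl; have [mR ET] := fR.
pose g' := [ffun z => if root R z == root R x then g z else z].
have invg' : involutive g'.
  move=> z; rewrite !ffunE; case: (eqVneq (root R z) (root R x)) => [E|/negbTE ->//].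
  by rewrite cl // eqxx invg.
have [|//|r [_ cr er]] := @exit_exists _ R d g' x sR mR invg'.
- move=> z _ _ _; rewrite ET connect_full; apply/root_eqP => //.
  by rewrite ffunE; case: eqP => // E; rewrite cl.
- by rewrite ET inE.
have Er : root R r = root R x by apply/esym/root_eqP => //; rewrite -connect_full -ET.
exists r => //; move: er; rewrite /exit ET inE orbF ffunE Er eqxx; exact: eqP.
Qed.

Lemma full_mtch : exists2 f, mtch R f & nfix f = d.
Proof.
have [mR ET] := fR; have [x _|T0] := pickP (mem T).
  have : x \in missable R d by rewrite ET inE.
  by case/missableP=> f [mf nf _]; exists f.
have mid : mtch R [ffun x => x] by apply/mtchP; split=> x; have := T0 x.
exists [ffun x => x] => //; apply/eqP; rewrite eqn_leq mR // andbT.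
suff -> : nfix [ffun x : T => x] = 0 by [].
by apply: eq_card0 => x; have := T0 x.
Qed.

Lemma root_fixpts f : mtch R f -> root R @: fixpts f = root R @: setT.
Proof.
move=> mf; apply/setP=> c; apply/imsetP/imsetP=> -[x _ ->]; first by exists x.
have [|z Ez fz] := @full_odd f x (mtch_inv mf).
  move=> z <-; have [->//|fz] := eqVneq (f z) z.
  by apply/esym/root_edge => //; apply: mtch_rel mf fz.
by exists z => //; rewrite inE fz.
Qed.

Lemma card_classes : #|root R @: setT| = d.
Proof.
have [f mf nf] := full_mtch; rewrite -(root_fixpts mf) card_in_imset //.
by move=> x y; rewrite !inE => /eqP fx /eqP fy; apply: full_unique mf nf fx fy.
Qed.

(** The vertex to be missed can be chosen in each component independently: [f] uses on each
    component the matching [F v] for its chosen vertex [v]. *)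
Lemma full_select (s : seq T) : uniq (map (root R) s) ->
  exists f, [/\ mtch R f, nfix f = d & forall x, x \in s -> f x = x].
Proof.
move=> us; have [mR ET] := fR.
have /fin_all_exists[F HF] v : exists f, [/\ mtch R f, nfix f = d & f v = v].
  by apply/missableP; rewrite ET inE.
(* The default [root R x] is the chosen vertex of a component without a member of [s]. *)
pose r x := nth (root R x) s (index (root R x) (map (root R) s)).
have rr x : root R (r x) = root R x.
  have [xs|xs] := boolP (root R x \in map (root R) s).
    have := nth_index (root R x) xs.
    by rewrite (nth_map (root R x)) // -(size_map (root R)) index_mem.
  rewrite /r nth_default ?(root_root (sym_connect_sym sR)) //.
  by rewrite leqNgt -(size_map (root R)) index_mem.
have rs x : x \in s -> r x = x by apply/nth_index_map/uniq_map_injective.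
have req x y : root R x = root R y -> r x = r y.
  move=> E; rewrite /r -E; have [xs|xs] := boolP (root R x \in map (root R) s).
    by apply: set_nth_default; rewrite -(size_map (root R)) index_mem.
  by rewrite !nth_default // leqNgt -(size_map (root R)) index_mem.
pose f := [ffun x => F (r x) x].
have rF v x : root R (F v x) = root R x.
  have [mF _ _] := HF v; have [->//|Fx] := eqVneq (F v x) x.
  by apply/esym/root_edge => //; apply: mtch_rel mF Fx.
have mf : mtch R f.
  apply/mtchP; split=> x; rewrite !ffunE.
    by rewrite (req _ _ (rF _ x)); have [mF _ _] := HF (r x); rewrite (mtch_inv mF).
  by have [mF _ _] := HF (r x); apply: mtch_rel.
have fixf x : f x = x -> x = r x.
  rewrite ffunE => Fx; have [mF nF Frx] := HF (r x).
  by apply: (full_unique mF nF).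
exists f; split=> // [|x xs]; last first.
  by rewrite ffunE rs //; have [_ _ ->] := HF x.
rewrite -card_classes -(root_fixpts mf) card_in_imset //.
move=> x y; rewrite !inE => /eqP/fixf {2}-> /eqP/fixf {2}->; exact: req.
Qed.

Lemma class_odd x : odd #|[set z | root R z == root R x]|.
Proof.
have [f [mf nf fx]] := @full_select [:: x] isT.
rewrite (involution_parity (mtch_inv mf)).
  suff -> : [set z | root R z == root R x] :&: fixpts f = [set x] by rewrite cards1.
  apply/setP=> z; rewrite !inE; apply/andP/eqP=> [[/eqP E /eqP fz]|->].
    by apply: (full_unique mf nf) => //; apply: fx; rewrite inE.
  by rewrite fx ?inE ?eqxx.
move=> z; rewrite !inE => /eqP <-; have [->//|fz] := eqVneq (f z) z.
by apply/eqP/esym/root_edge => //; apply: mtch_rel mf fz.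
Qed.

End FullTheory.

Definition joins R (A B : T) x y :=
  (root R x == A) && (root R y == B) || (root R x == B) && (root R y == A).

(* Three components joined pairwise merge into one: a vertex of the first is
   missed by using the edge between the other two. *)
Lemma full_triangle R Q d A B C : symmetric R -> symmetric Q -> full R d.+2 ->
  uniq [:: root R A; root R B; root R C] -> subrel R Q ->
  (forall x y, Q x y -> [|| R x y, joins R (root R A) (root R B) x y,
     joins R (root R A) (root R C) x y | joins R (root R B) (root R C) x y]) ->
  (exists x y, [/\ Q x y, root R x = root R A & root R y = root R B]) ->
  (exists x y, [/\ Q x y, root R x = root R A & root R y = root R C]) ->
  (exists x y, [/\ Q x y, root R x = root R B & root R y = root R C]) ->
  full Q d.
Proof.
move=> sR sQ fR uABC sub HQ eAB eAC eBC.
have lnk v x y : uniq [:: root R v; root R x; root R y] -> Q x y -> v \in missable Q d.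
  move=> u Qxy; have [f [mf nf fx]] := @full_select _ _ sR fR [:: v; x; y] u.
  have [fv fx' fy] : [/\ f v = v, f x = x & f y = y] by split; apply: fx; rewrite !inE eqxx ?orbT.
  have [vx vy xy] : [/\ root R v != root R x, root R v != root R y & root R x != root R y].
    by move: u; rewrite /= !inE negb_or => /and3P[/andP[]].
  have Qyx : Q y x by rewrite sQ.
  have xy' : x != y by apply: contraNneq xy => ->.
  have mk := mtch_link (sub_mtch sub mf) Qxy Qyx fx' fy.
  apply: (in_missable mk).
    by have := nfix_link fx' fy xy'; rewrite nf => -[].
  rewrite ffunE; case: eqP => [e|_]; first by rewrite e eqxx in vx.
  by case: eqP => [e|_] //; rewrite e eqxx in vy.
have [AB AC BC] : [/\ root R A != root R B, root R A != root R C & root R B != root R C].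
  by move: uABC; rewrite /= !inE negb_or => /and3P[/andP[]].
split.
  move=> g mg.
  (* The union of three odd components is odd and closed under [g], so [g] misses a vertex in it;
     the other [d + 2 - 3] components contribute one each. *)
  pose S := [set z | root R z \in [:: root R A; root R B; root R C]].
  have jS x y X Y : joins R X Y x y -> X \in [:: root R A; root R B; root R C] ->
      Y \in [:: root R A; root R B; root R C] -> x \in S /\ y \in S.
    by move=> + HX HY; rewrite 2!in_set; case/orP=> /andP[/eqP-> /eqP->].
  have QS x y : Q x y -> root R x = root R y \/ x \in S /\ y \in S.
    move=> /HQ/or4P[Rxy|j|j|j]; first by left; apply: root_edge.
    - by right; apply: (jS _ _ _ _ j); rewrite !inE eqxx ?orbT.
    - by right; apply: (jS _ _ _ _ j); rewrite !inE eqxx ?orbT.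
    - by right; apply: (jS _ _ _ _ j); rewrite !inE eqxx ?orbT.
  have oddS : odd #|S|.
    have -> : S = [set z | root R z == root R A] :|:
        ([set z | root R z == root R B] :|: [set z | root R z == root R C]).
      by apply/setP=> z; rewrite !inE.
    have dj X Y : X != Y -> [set z | root R z == X] :&: [set z | root R z == Y] = set0.
      move=> XY; apply/setP=> z; rewrite !inE; apply/negP=> /andP[/eqP-> /eqP e].
      by rewrite e eqxx in XY.
    rewrite cardsU setIUr !dj // setU0 cards0 subn0 cardsU dj // cards0 subn0.
    by rewrite !oddD !(class_odd sR fR).
  have [s sS gs] : exists2 s, s \in S & g s = s.
    have [E|[s]] := set_0Vmem (S :&: fixpts g); last first.
      by rewrite in_setI [s \in fixpts g]inE => /andP[sS /eqP gs]; exists s.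
    move: oddS; rewrite (involution_parity (mtch_inv mg)) ?E ?cards0 //.
    move=> x xS; have [->//|gx] := eqVneq (g x) x.
    case: (QS _ _ (mtch_rel mg gx)) => [E'|[_ //]].
    by move: xS; rewrite !in_set E'.
  pose L := [set root R A; root R B; root R C].
  have sub1 : root R s |: (root R @: setT :\: L) \subset root R @: fixpts g.
    apply/subsetP=> c /setU1P[->|/setDP[/imsetP[x _ ->] xL]].
      by apply/imsetP; exists s; rewrite // inE gs.
    have [|z Ez gz] := @full_odd _ _ sR fR g x (mtch_inv mg).
      move=> z Ez; have [->//|gz] := eqVneq (g z) z.
      case: (QS _ _ (mtch_rel mg gz)) => [E'|[zS _]]; first by rewrite -E' Ez.
      by move: xL zS; rewrite -Ez /L !inE -!orbA => /negbTE->.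
    by apply/imsetP; exists z => //; rewrite inE gz.
  have := leq_trans (subset_leq_card sub1) (leq_imset_card _ _).
  rewrite cardsU1 -/(nfix g) cardsD (card_classes sR fR) => H; apply: leq_trans H.
  have -> : root R s \notin root R @: setT :\: L.
    rewrite in_setD negb_and negbK; apply/orP; left.
    by move: sS; rewrite /L !inE -!orbA.
  have : #|root R @: setT :&: L| <= 3.
    apply: leq_trans (subset_leq_card (subsetIr _ _)) _.
    by rewrite /L !cardsU !cards1; lia.
  lia.
have [xa [yb [Q1 ra rb]]] := eAB; have [xa' [yc [Q2 ra' rc]]] := eAC.
have [xb [yc' [Q3 rb' rc']]] := eBC.
apply/setP=> v; rewrite [RHS]inE.
have [vA|vA] := eqVneq (root R v) (root R A).
  by apply: lnk Q3; rewrite rb' rc' vA.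
have [vB|vB] := eqVneq (root R v) (root R B).
  by apply: lnk Q2; rewrite ra' rc vB /= !inE negb_or (eq_sym (root R B)) AB BC AC.
have [vC|vC] := eqVneq (root R v) (root R C).
  by apply: lnk Q1; rewrite ra rb vC /= !inE negb_or !(eq_sym (root R C)) AB BC AC.
by apply: lnk Q1; rewrite ra rb /= !inE negb_or vA vB AB.
Qed.

End Full.

(** * Edge-coloured graphs *)

Section Coloured.

Variables I T : finType.
Implicit Types (G H : {set I * T * T}) (f g h : {ffun T -> T}) (p q r : I * T * T).
Implicit Types (a u v w x y z : T) (d : nat).

(* An element [(i, x, y)] of [G] is the edge [xy] in colour [i]; the orientation is
   irrelevant. *)
Definition adj G : rel T := [rel x y | [exists i, ((i, x, y) \in G) || ((i, y, x) \in G)]].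

Lemma adj_sym G : symmetric (adj G).
Proof. by move=> x y; apply: eq_existsb => i; rewrite orbC. Qed.

Lemma adjP G x y : reflect (exists2 p, p \in G & (p.1.2, p.2) = (x, y) \/ (p.1.2, p.2) = (y, x))
  (adj G x y).
Proof.
apply: (iffP existsP) => [[i /orP[]]|[[[i u] v] pG [[<- <-]|[<- <-]]]].
- by exists (i, x, y) => //; left.
- by exists (i, y, x) => //; right.
- by exists i; rewrite pG.
- by exists i; rewrite pG orbT.
Qed.

Lemma sub_adj G H : G \subset H -> subrel (adj G) (adj H).
Proof. by move=> /subsetP s x y /adjP[p pG E]; apply/adjP; exists p => //; apply: s. Qed.

Lemma adj_in G p : p \in G -> adj G p.1.2 p.2.
Proof. by move=> pG; apply/adjP; exists p => //; left. Qed.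

Lemma adjU1 G p x y : adj (p |: G) x y = addedge (adj G) p.1.2 p.2 x y.
Proof.
apply/adjP/or3P=> [[q /setU1P[-> [[-> ->]|[-> ->]]|qG E]]|[/adjP[q qG E]|/andP[/eqP-> /eqP->]|/andP[/eqP-> /eqP->]]].
- by apply: Or32; rewrite !eqxx.
- by apply: Or33; rewrite !eqxx.
- by apply: Or31; apply/adjP; exists q.
- by exists q => //; apply/setU1P; right.
- by exists p; [apply: setU11 | left].
- by exists p; [apply: setU11 | right].
Qed.

Lemma sub_minfix (R Q : rel T) d : subrel R Q -> minfix Q d -> minfix R d.
Proof. by move=> s mQ f /(sub_mtch s)/mQ. Qed.

Lemma eq_missable (R Q : rel T) d : R =2 Q -> missable R d = missable Q d.
Proof.
move=> E; apply/eqP; rewrite eqEsubset !sub_missable // => x y.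
  by rewrite E.
by rewrite -E.
Qed.

Lemma eq_full (R Q : rel T) d : R =2 Q -> full Q d -> full R d.
Proof.
move=> E [mQ ET]; split; last by rewrite (eq_missable _ E).
by apply: sub_minfix mQ => x y; rewrite E.
Qed.

Lemma matching_edges G f : mtch (adj G) f ->
  exists G', [/\ G' \subset G, mtch (adj G') f & 2 * #|G'| + nfix f <= #|T|].
Proof.
move=> mf; have invf := mtch_inv mf.
have /fin_all_exists[c Hc] x : exists p : option (I * T * T), x \in lower f ->
    if p is Some q then q \in G /\ ((q.1.2, q.2) = (x, f x) \/ (q.1.2, q.2) = (f x, x)) else False.
  have [xl|_] := boolP (x \in lower f); last by exists None.
  have fx : f x != x by apply: contraTneq xl => e; rewrite inE e ltnn.
  by have /adjP[q qG E] := mtch_rel mf fx; exists (Some q).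
pose G' := [set p | Some p \in c @: lower f].
have sG : G' \subset G.
  apply/subsetP=> p; rewrite inE => /imsetP[x xl E].
  by have := Hc x xl; rewrite -E => -[].
have lowG x : x \in lower f -> adj G' x (f x).
  move=> xl; have := Hc x xl; case E: (c x) => [q|] // [qG Eq].
  by apply/adjP; exists q => //; rewrite inE -E imset_f.
exists G'; split=> //.
  apply/mtchP; split=> // x fx; case/orP: (lowerP invf fx) => [/lowG //|/lowG].
  by rewrite invf adj_sym.
have le1 : #|G'| <= #|lower f|.
  apply: leq_trans (leq_imset_card c (lower f)).
  rewrite -(card_imset _ (@Some_inj _)); apply: subset_leq_card.
  by apply/subsetP=> _ /imsetP[p + ->]; rewrite inE.
by rewrite -(card_lower invf) leq_add2r leq_mul2l.
Qed.

Lemma joins_swap (R : rel T) A B x y : joins R A B x y = joins R A B y x.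
Proof. by rewrite /joins orbC; congr orb; rewrite andbC. Qed.

Lemma full_add_triangle G d A B C p q r : full (adj G) d.+2 ->
  uniq [:: root (adj G) A; root (adj G) B; root (adj G) C] ->
  joins (adj G) (root (adj G) A) (root (adj G) B) p.1.2 p.2 ->
  joins (adj G) (root (adj G) A) (root (adj G) C) q.1.2 q.2 ->
  joins (adj G) (root (adj G) B) (root (adj G) C) r.1.2 r.2 ->
  full (adj (p |: (q |: (r |: G)))) d.
Proof.
move=> fG u jp jq jr; set G' := p |: _.
have ex X Y s : s \in G' -> joins (adj G) X Y s.1.2 s.2 ->
    exists x y, [/\ adj G' x y, root (adj G) x = X & root (adj G) y = Y].
  move=> sG /orP[]/andP[/eqP E1 /eqP E2]; first by exists s.1.2, s.2; split=> //; apply: adj_in.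
  by exists s.2, s.1.2; split=> //; rewrite adj_sym; apply: adj_in.
apply: (full_triangle (@adj_sym G) (@adj_sym G') fG u).
- by apply: sub_adj; apply/subsetP=> s sG; rewrite !inE sG !orbT.
- move=> x y /adjP[s]; rewrite !in_setU1 => /or4P[/eqP->|/eqP->|/eqP->|sG] E.
  + by apply/orP; right; apply/orP; left; case: E => -[<- <-] //; rewrite joins_swap.
  + by do 2!(apply/orP; right); apply/orP; left; case: E => -[<- <-] //; rewrite joins_swap.
  + by do 3!(apply/orP; right); case: E => -[<- <-] //; rewrite joins_swap.
  + by apply/orP; left; apply/adjP; exists s.
- by apply: ex jp; rewrite !inE eqxx.
- by apply: ex jq; rewrite !inE eqxx !orbT.
- by apply: ex jr; rewrite !inE eqxx !orbT.
Qed.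

(** Vertices in two components of [R] are missed together by a maximum matching, which is still
    maximum for [Q]; so the larger graph cannot have merged these components. *)
Lemma sub_full_root (R Q : rel T) d x y : symmetric R -> symmetric Q -> subrel R Q ->
  full R d -> full Q d -> root Q x = root Q y -> root R x = root R y.
Proof.
move=> sR sQ sRQ fR fQ E; apply/eqP/negPn/negP=> N.
have u : uniq [:: root R x; root R y] by rewrite /= inE N.
have [f [mf nf fix2]] := full_select sR fR (s := [:: x; y]) u.
have xy : x = y.
  by apply: (full_unique sQ fQ (sub_mtch sRQ mf) nf) => //; apply: fix2; rewrite !inE eqxx ?orbT.
by rewrite xy eqxx in N.
Qed.

Lemma root_sub (R Q : rel T) x y : symmetric R -> symmetric Q -> subrel R Q ->
  root R x = root R y -> root Q x = root Q y.
Proof.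
move=> sR sQ s /(root_eqP x y sR) c; apply/(root_eqP x y sQ).
by apply: connect_sub c => u v /s; apply: connect1.
Qed.

(* With [m] matching edges, [|T| - d = 2 * m], so [G] has [3 * m] edges and no
   full subgraph of [G] with the same components has fewer. *)
Definition tight G d := [/\ full (adj G) d, 2 * #|G| + 3 * d = 3 * #|T|
  & forall G', G' \subset G -> full (adj G') d -> 3 * #|T| <= 2 * #|G'| + 3 * d].

(* Add edges of [G] to a maximum matching, each enlarging the missable set, as
   slowly as tightness forces: before the last step a single vertex [a] is not
   missable, its removal gives [G0], and the removed edges are two edges at [a]
   and the last edge. *)
Lemma decompose G d : tight G d -> d < #|T| ->
  exists G0 p q r A B C, [/\ G0 \subset G, tight G0 d.+2,
    [/\ p \in G :\: G0, q \in G :\: G0, r \in G :\: G0 & uniq [:: p; q; r]],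
    uniq [:: root (adj G0) A; root (adj G0) B; root (adj G0) C]
  & [/\ joins (adj G0) (root (adj G0) A) (root (adj G0) B) p.1.2 p.2,
        joins (adj G0) (root (adj G0) A) (root (adj G0) C) q.1.2 q.2
      & joins (adj G0) (root (adj G0) B) (root (adj G0) C) r.1.2 r.2]].
Proof.
move=> [fG eG tG] ltdT; have [mG ETG] := fG.
have ar1 (a b c N : nat) : 2 * a + b <= N -> b + c <= N -> 2 * a + 2 * c + 3 * b <= 3 * N by lia.
have ar2 (a b N : nat) : 2 * a + b <= N -> 3 * N <= 2 * a + 3 * b -> b < N -> False by lia.
have ar3 (a a' b c c' N : nat) : 2 * a + 2 * c + 3 * b <= N -> c' < c -> a' <= a.+1 ->
  2 * a' + 2 * c' + 3 * b <= N by lia.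
have ar4 (a a' b c N : nat) : 2 * a + 2 * c + 3 * b <= N -> a' <= a.+1 -> N <= 2 * a' + 3 * b -> 0 < c -> c = 1.
  by lia.
have ar5 (x y m N : nat) : x = y + 3 -> x <= m -> 2 * m + 3 * d = 3 * N ->
  3 * N <= 2 * x + 3 * d -> 2 * y + 3 * d.+2 = 3 * N by lia.
have ar6 (x y N : nat) : x = y + 3 -> 3 * N <= 2 * x + 3 * d -> 3 * N <= 2 * y + 3 * d.+2.
  by lia.
have [n En] : exists n, #|T| = n by exists #|T|.
rewrite En in eG ltdT; have {}tG G' (s : G' \subset G) (F : full (adj G') d) : 3 * n <= 2 * #|G'| + 3 * d.
  by rewrite -En; apply: tG.
have [f mf nf] := full_mtch fG.
have [Gf [sGf mfGf leGf]] := matching_edges mf; rewrite En nf in leGf.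
pose D (X : {set I * T * T}) := missable (adj X) d.
(* Each edge costs 2 and is paid for by a vertex that becomes missable; [P] collects the sets within
   this budget that are not yet full. *)
pose P (X : {set I * T * T}) := [&& X \subset G, mtch (adj X) f,
  2 * #|X| + 2 * #|~: D X| + 3 * d <= 3 * n & D X != setT].
have sub_minG (X : {set I * T * T}) : X \subset G -> minfix (adj X) d.
  by move=> sX; apply: sub_minfix mG; apply: sub_adj.
have fixD (X : {set I * T * T}) x : mtch (adj X) f -> f x = x -> x \in D X.
  by move=> mX; apply: in_missable.
have cD (X : {set I * T * T}) : mtch (adj X) f -> d + #|~: D X| <= n.
  move=> mX; rewrite -En -(cardsC (D X)) leq_add2r -nf; apply: subset_leq_card.
  by apply/subsetP=> x; rewrite [_ \in fixpts f]inE => /eqP; apply: fixD.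
have PGf : P Gf.
  rewrite /P sGf mfGf /=; apply/andP; split; first exact: ar1 leGf (cD _ mfGf).
  apply/eqP=> E; exact: ar2 leGf (tG Gf sGf (conj (sub_minG _ sGf) E)) ltdT.
(* By minimality, any edge of [G] that enlarges the missable set of [G'] makes the graph full. *)
pose G' := [arg min_(X < Gf | P X) #|~: D X|].
have [/and4P[sG' mfG' leG' nT] minG'] : P G' /\ forall X, P X -> #|~: D G'| <= #|~: D X|.
  by rewrite /G'; case: arg_minnP.
have [v0 v0D] : exists v, v \notin D G'.
  by apply/existsP; rewrite -negb_forall; apply: contra nT => /forallP H; apply/eqP/setP=> x; rewrite H inE.
have [p pG /andP[pxy Dp]] : exists2 p, p \in G &
    (p.1.2 != p.2) && (missable (addedge (adj G') p.1.2 p.2) d != D G').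
  apply/exists_inP; case: exists_inP => // H; exfalso.
  have {}H q : q \in G -> ~~ ((q.1.2 != q.2) && (missable (addedge (adj G') q.1.2 q.2) d != D G')).
    by move=> qG; apply/negP=> Hq; apply: H; exists q.
  (* A maximum matching of [G] misses [v0]. If no edge of [G] enlarged the missable set, [enlarge]
     would place all [d] missed vertices inside [D G'], leaving none for [v0]. *)
  have : v0 \in missable (adj G) d by rewrite ETG inE.
  case/missableP=> g [mg ng gv0].
  have HQ : forall x y, adj G x y -> x != y ->
      minfix (addedge (adj G') x y) d /\ missable (addedge (adj G') x y) d = missable (adj G') d.
    move=> x y Gxy xy; split.
      apply: sub_minfix mG => u v /or3P[/(sub_adj sG')//|/andP[/eqP-> /eqP->]//|/andP[/eqP-> /eqP->]].
      by rewrite adj_sym.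
    have /adjP[p pG E] := Gxy; have := H p pG.
    case: E => -[-> ->]; rewrite ?(eq_sym y) xy /= negbK => /eqP E //.
    by rewrite -/(D G') -E; apply: eq_missable => u v; rewrite /addedge /= orbCA orbC -orbA; congr orb; rewrite orbC.
  have mg' : mtch [rel x y | adj G' x y || adj G x y] g.
    by apply: sub_mtch mg => x y Gxy; apply/orP; right.
  have := enlarge (@adj_sym _) (@adj_sym _) (sub_minG _ sG') (ex_intro2 _ _ f mfG' nf) HQ mg'.
  apply/negP; rewrite -ltnNge -{2}ng; apply: proper_card; apply/properP; split; first exact: subsetIl.
  by exists v0; rewrite ?in_setI ?(negbTE v0D) ?andbF // inE gv0.
pose G1 := p |: G'.
have sG1 : G1 \subset G by rewrite subUset sub1set pG.
have mfG1 : mtch (adj G1) f by apply: sub_mtch mfG'; apply/sub_adj/subsetUr.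
have properD : D G' \proper D G1.
  rewrite properEneq [D G1](@eq_missable _ (addedge (adj G') p.1.2 p.2)); last exact: adjU1.
  by rewrite eq_sym Dp /=; apply/sub_missable/sub_addedge.
have ltD : #|~: D G1| < #|~: D G'| by apply: proper_card; rewrite properC.
have leG1 : #|G1| <= #|G'|.+1 by rewrite cardsU1; case: (p \notin G').
have fG1 : full (adj G1) d.
  split; first exact: sub_minG.
  apply/eqP/negPn/negP=> N; have : P G1.
    by rewrite /P sG1 mfG1 N andbT /=; apply: ar3 leG' ltD leG1.
  by move/minG'; rewrite leqNgt ltD.
(* Tightness bounds [#|G1|] from below; against the budget of [G'] this leaves room for a single
   vertex. *)
have Da : #|~: D G'| = 1.
  apply: ar4 leG' leG1 (tG G1 sG1 fG1) _; rewrite lt0n cards_eq0.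
  by apply: contra nT => /eqP E; rewrite -(setCK (D G')) E setC0.
have [a Ea] := cards1P (introT eqP Da).
have aD : a \notin D G' by rewrite -in_setC Ea set11.
have inD z : z != a -> z \in D G'.
  by apply: contraNT; rewrite -in_setC Ea in_set1.
have fa : f a != a by apply: contraNneq aD; apply: fixD.
have Raf : adj G' (f a) a by rewrite adj_sym; apply: mtch_rel mfG' fa.
have [mdel Edel] := del_missable (@adj_sym G') (sub_minG _ sG') aD (inD _ fa) Raf.
pose G0 := [set q in G' | (q.1.2 != a) && (q.2 != a)].
have adjG0 : adj G0 =2 del (adj G') a.
  move=> x y; apply/adjP/and3P=> [[q + E]|[/adjP[q qG E] xa ya]].
    rewrite inE => /and3P[qG q1 q2]; split; first by apply/adjP; exists q.
      by case: E q1 q2 => -[-> ->].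
    by case: E q1 q2 => -[-> ->].
  by exists q => //; rewrite inE qG; case: E => -[-> ->]; rewrite xa ya.
have fG0 : full (adj G0) d.+2.
  apply: (eq_full adjG0); split=> //; rewrite Edel; apply/setP=> z; rewrite in_setU1 [RHS]inE.
  by case: eqVneq => //= /inD.
have sG01 : G0 \subset G1.
  by apply/subsetP=> q; rewrite inE => /and3P[qG _ _]; apply/setU1P; right.
have unlinkG0 g : mtch (adj G') g -> nfix g = d ->
    [/\ g a != a, mtch (adj G0) (unlink g a) & nfix (unlink g a) = d.+2].
  move=> mg ng; have ga : g a != a by apply: contraNneq aD; apply: in_missable mg ng.
  split=> //; last by rewrite nfix_unlink ?ng //; apply: mtch_inv mg.
  by apply: sub_mtch (mtch_unlink a mg) => x y; rewrite adjG0.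
set ro := root (adj G0).
have uniq0 g x y : mtch (adj G0) g -> nfix g = d.+2 -> g x = x -> g y = y -> x != y -> ro x != ro y.
  move=> mg ng gx gy; apply: contraNneq => E.
  by apply/eqP; apply: (full_unique (@adj_sym G0) fG0 mg ng gx gy).
(* [w] is the mate of [a] under [f], and [v] its mate under a maximum matching [h] missing [w].
   Unlinking [a] in [h] leaves [a], [w] and [v] unmatched, hence in three components. *)
have [w [v [Raw Rav wv aw av]]] : exists w v, [/\ adj G' a w, adj G' a v, ro w != ro v, ro a != ro w & ro a != ro v].
  have /missableP[h [mh nh hw]] := inD _ fa.
  have [ha mu nu] := unlinkG0 h mh nh.
  have faha : f a != h a by apply: contraNneq fa => e; rewrite -hw e (mtch_inv mh).
  have hu z : (z == a) || (z == h a) -> unlink h a z = z by rewrite ffunE => ->.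
  have uf : unlink h a (f a) = f a by rewrite ffunE hw if_same.
  exists (f a), (h a); split.
  - by rewrite adj_sym.
  - exact: mtch_rel mh ha.
  - by apply: (uniq0 _ _ _ mu nu) => //; apply: hu; rewrite eqxx orbT.
  - by apply: (uniq0 _ _ _ mu nu) => //; rewrite ?(eq_sym a) // hu ?eqxx.
  - by apply: (uniq0 _ _ _ mu nu) => //; rewrite ?(eq_sym a) // hu ?eqxx ?orbT.
have [g [mg ng ga]] : exists g, [/\ mtch (adj G1) g, nfix g = d & g a = a].
  by apply/missableP; have [_ ->] := fG1; rewrite inE.
have G1G' u z : adj G1 u z -> (u, z) <> (p.1.2, p.2) -> (u, z) <> (p.2, p.1.2) -> adj G' u z.
  rewrite adjU1 => /or3P[//|/andP[/eqP-> /eqP->]|/andP[/eqP-> /eqP->]] //.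
(* A maximum matching of [G1] missing [a] must use the new edge [p], as [a] is not missable in
   [G']. *)
have gp : g p.1.2 = p.2.
  apply/eqP/negPn/negP=> N; have : a \in D G'; last exact/negP.
  apply: (in_missable (f := g)) => //; apply/mtchP; split; first exact: mtch_inv mg.
  move=> z gz; apply: G1G' (mtch_rel mg gz) _ _ => -[E1 E2].
    by rewrite -E1 E2 eqxx in N.
  by rewrite -E2 -E1 (mtch_inv mg) eqxx in N.
have gp' : g p.2 = p.1.2 by rewrite -gp (mtch_inv mg).
pose g0 := unlink g p.1.2.
have g0fix z : (z == p.1.2) || (z == p.2) -> g0 z = z by rewrite ffunE gp => ->.
have pa z : (z == p.1.2) || (z == p.2) -> z != a.
  move=> zp; apply/eqP=> za; move: zp ga; rewrite za.
  by case/orP=> /eqP E e; move: pxy; [rewrite -gp | rewrite -gp']; rewrite -E e eqxx.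
have g0a : g0 a = a by rewrite ffunE ga if_same.
have mg0 : mtch (adj G0) g0.
  apply/mtchP; split=> [|z].
    by have := mtch_unlink p.1.2 mg => /mtch_inv.
  rewrite ffunE gp; case: ifP => [_|/negbT]; first by rewrite eqxx.
  rewrite negb_or => /andP[z1 z2] gz; rewrite adjG0; apply/and3P; split.
  - apply: G1G' (mtch_rel mg gz) _ _ => -[E1 E2]; first by rewrite E1 eqxx in z1.
    by rewrite E1 eqxx in z2.
  - by apply: contraNneq gz => ->; rewrite ga.
  - by apply: contraNneq gz => e; have := mtch_inv mg z; rewrite e ga => <-.
have ng0 : nfix g0 = d.+2.
  by rewrite nfix_unlink ?ng ?gp 1?eq_sym //; apply: mtch_inv mg.
have rxy : ro p.1.2 != ro p.2 by apply: (uniq0 _ _ _ mg0 ng0); rewrite ?g0fix ?eqxx ?orbT.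
have rax : ro a != ro p.1.2 by apply: (uniq0 _ _ _ mg0 ng0 g0a); rewrite ?g0fix ?eqxx // eq_sym pa ?eqxx.
have ray : ro a != ro p.2 by apply: (uniq0 _ _ _ mg0 ng0 g0a); rewrite ?g0fix ?eqxx ?orbT // eq_sym pa ?eqxx ?orbT.
(* Otherwise a maximum matching of [G0] missing [a], [u] and both ends of [p] could take the edges
   [au] and [p], leaving fewer than [d] vertices. *)
have near u : adj G' a u -> ro a != ro u -> (ro u == ro p.1.2) || (ro u == ro p.2).
  move=> Rau rau; apply/negPn/negP; rewrite negb_or => /andP[ux uy].
  have [|k [mk nk fk]] := @full_select _ _ _ (@adj_sym G0) fG0 [:: a; u; p.1.2; p.2].
    by rewrite /= !inE -/ro !negb_or rau rax ray ux uy rxy.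
  have ka : k a = a by apply: fk; rewrite !inE eqxx.
  have ku : k u = u by apply: fk; rewrite !inE eqxx ?orbT.
  have kx : k p.1.2 = p.1.2 by apply: fk; rewrite !inE eqxx ?orbT.
  have ky : k p.2 = p.2 by apply: fk; rewrite !inE eqxx ?orbT.
  have ne z t : ro z != ro t -> z != t by apply: contraNneq => ->.
  have mk1 : mtch (adj G1) k by apply: sub_mtch mk; apply: sub_adj.
  have Gau : adj G1 a u by apply: sub_adj Rau; apply: subsetUr.
  have Gxy : adj G1 p.1.2 p.2 by apply: adj_in; apply: setU11.
  have lx : link k a u p.1.2 = p.1.2.
    by rewrite ffunE !(eq_sym p.1.2) (negbTE (ne _ _ rax)) (negbTE (ne _ _ ux)).
  have ly : link k a u p.2 = p.2.
    by rewrite ffunE !(eq_sym p.2) (negbTE (ne _ _ ray)) (negbTE (ne _ _ uy)).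
  have m2 := mtch_link mk1 Gau (etrans (adj_sym _ _ _) Gau) ka ku.
  have m3 := mtch_link m2 Gxy (etrans (adj_sym _ _ _) Gxy) lx ly.
  have := sub_minG _ sG1 _ m3.
  have := nfix_link lx ly pxy; have := nfix_link ka ku (ne _ _ rau); rewrite nk => -[<-] <-.
  by rewrite ltnNge leqnSn.
have nearw := near _ Raw aw; have nearv := near _ Rav av.
have [q1 q1G Eq1] := adjP _ _ _ Raw; have [q2 q2G Eq2] := adjP _ _ _ Rav.
have q1a : q1 \notin G0 by rewrite inE q1G; case: Eq1 => -[-> ->]; rewrite eqxx ?andbF.
have q2a : q2 \notin G0 by rewrite inE q2G; case: Eq2 => -[-> ->]; rewrite eqxx ?andbF.
have pnG' : p \notin G'.
  by apply: contraNN Dp => pG'; apply/eqP/eq_missable=> u z; rewrite -adjU1 (setUidPr _) // sub1set.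
have wv' : w != v by apply: contraNneq wv => ->.
have wa : w != a by apply: contraNneq aw => ->.
have va : v != a by apply: contraNneq av => ->.
have q12 : q1 != q2.
  apply/eqP=> E; case: Eq1 Eq2 => -[E1 E2] [] [E3 E4]; rewrite -E in E3 E4.
  - by rewrite -E2 E4 eqxx in wv'.
  - by rewrite -E1 E3 eqxx in va.
  - by rewrite -E1 E3 eqxx in wa.
  - by rewrite -E1 E3 eqxx in wv'.
have pq1 : p != q1 by apply: contraNneq pnG' => ->.
have pq2 : p != q2 by apply: contraNneq pnG' => ->.
have pG0 : p \notin G0 by rewrite inE (negbTE pnG').
have uabc : uniq [:: ro a; ro w; ro v] by rewrite /= !inE negb_or aw av wv.
have j1 : joins (adj G0) (ro a) (ro w) q1.1.2 q1.2.
  by rewrite /joins -/ro; case: Eq1 => -[-> ->]; rewrite !eqxx ?orbT.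
have j2 : joins (adj G0) (ro a) (ro v) q2.1.2 q2.2.
  by rewrite /joins -/ro; case: Eq2 => -[-> ->]; rewrite !eqxx ?orbT.
have j3 : joins (adj G0) (ro w) (ro v) p.1.2 p.2.
  rewrite /joins -/ro !(eq_sym (ro p.1.2)) !(eq_sym (ro p.2)).
  case/orP: nearw => /eqP E; case/orP: nearv => /eqP E'; rewrite -?E -?E' ?eqxx ?orbT //.
  - by rewrite E E' eqxx in wv.
  - by rewrite E E' eqxx in wv.
have sub0 : G0 \subset G by apply: subset_trans sG1.
have q1G' : q1 \in G by apply: (subsetP sG').
have q2G' : q2 \in G by apply: (subsetP sG').
have card3 (X : {set I * T * T}) : X \subset G0 ->
    #|q1 |: (q2 |: (p |: X))| = #|X| + 3 /\ q1 |: (q2 |: (p |: X)) \subset G.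
  move=> sX; have nX r : r \notin G0 -> r \notin X by apply: contraNN; apply/subsetP.
  rewrite !cardsU1 !in_setU1 !negb_or q12 (eq_sym q1) pq1 (eq_sym q2) pq2 !nX //.
  by rewrite !subUset !sub1set q1G' q2G' pG (subset_trans sX) // addn3.
have [c0 s0] := card3 G0 (subxx _).
have f0 := full_add_triangle fG0 uabc j1 j2 j3.
exists G0, q1, q2, p, a, w, v; split=> //; last first.
  rewrite /= !inE negb_or q12 (eq_sym q1) pq1 (eq_sym q2) pq2 q1G' q2G' pG.
  by rewrite inE in q1a; rewrite inE in q2a; rewrite inE in pG0; rewrite q1a q2a pG0.
rewrite /tight En; split=> //; first exact: ar5 c0 (subset_leq_card s0) eG (tG _ s0 f0).
(* A full subgraph of [G0] with the same [d.+2] has the same components, so the three edges complete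
   it to a full subgraph of [G]. *)
move=> X sX fX; have [cX sXG] := card3 X sX.
have rX x y : ro x = ro y -> root (adj X) x = root (adj X) y.
  exact: sub_full_root (@adj_sym X) (@adj_sym G0) (sub_adj sX) fX fG0.
have rX' x y : root (adj X) x = root (adj X) y -> ro x = ro y.
  exact: root_sub (@adj_sym X) (@adj_sym G0) (sub_adj sX).
have jX x y z t : joins (adj G0) (ro x) (ro y) z t -> joins (adj X) (root (adj X) x) (root (adj X) y) z t.
  by case/orP=> /andP[/eqP/rX E1 /eqP/rX E2]; rewrite /joins E1 E2 !eqxx ?orbT.
have uX : uniq [:: root (adj X) a; root (adj X) w; root (adj X) v].
  have nX x y : ro x != ro y -> root (adj X) x != root (adj X) y by apply: contraNneq => /rX' ->.
  by rewrite /= !inE negb_or (nX _ _ aw) (nX _ _ av) (nX _ _ wv).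
exact: ar6 cX (tG _ sXG (full_add_triangle fX uX (jX _ _ _ _ j1) (jX _ _ _ _ j2) (jX _ _ _ _ j3))).
Qed.

End Coloured.

(** * Rainbow matchings in finite graphs *)

(* Koenig's theorem for 3 x 3 boolean matrices without zero rows or columns: if
   no permutation fits, a row and a column cover all entries. *)
Lemma cross_shape_bool (w00 w01 w02 w10 w11 w12 w20 w21 w22 : bool) :
  [|| w00, w01 | w02] -> [|| w10, w11 | w12] -> [|| w20, w21 | w22] ->
  [|| w00, w10 | w20] -> [|| w01, w11 | w21] -> [|| w02, w12 | w22] ->
  ~~ [|| [&& w00, w11 & w22], [&& w00, w12 & w21], [&& w01, w10 & w22],
         [&& w01, w12 & w20], [&& w02, w10 & w21] | [&& w02, w11 & w20]] ->
  [|| ~~ [|| w11, w12, w21 | w22], ~~ [|| w10, w12, w20 | w22], ~~ [|| w10, w11, w20 | w21],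
      ~~ [|| w01, w02, w21 | w22], ~~ [|| w00, w02, w20 | w22], ~~ [|| w00, w01, w20 | w21],
      ~~ [|| w01, w02, w11 | w12], ~~ [|| w00, w02, w10 | w12] | ~~ [|| w00, w01, w10 | w11]].
Proof.
by case: w00; case: w01; case: w02; case: w10; case: w11; case: w12; case: w20; case: w21; case: w22.
Qed.

Lemma cross_shape (W : 'I_3 -> 'I_3 -> bool) :
  (forall i, exists s, W i s) -> (forall s, exists i, W i s) ->
  (forall i j l s p q, uniq [:: i; j; l] -> uniq [:: s; p; q] -> W i s -> W j p -> W l q -> False) ->
  exists i0 s0, forall i s, W i s -> i = i0 \/ s = s0.
Proof.
move=> rW cW pW.
pose o k (h : k < 3) : 'I_3 := Ordinal h.
pose o0 := @o 0 isT; pose o1 := @o 1 isT; pose o2 := @o 2 isT.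
have oP (i : 'I_3) : [\/ i = o0, i = o1 | i = o2].
  by case: i => [[|[|[|]]]] // h; [apply: Or31 | apply: Or32 | apply: Or33]; apply: val_inj.
have row i : [|| W i o0, W i o1 | W i o2].
  by have [s] := rW i; case: (oP s) => -> ->; rewrite ?orbT.
have col s : [|| W o0 s, W o1 s | W o2 s].
  by have [i] := cW s; case: (oP i) => -> ->; rewrite ?orbT.
have P : ~~ [|| [&& W o0 o0, W o1 o1 & W o2 o2], [&& W o0 o0, W o1 o2 & W o2 o1],
    [&& W o0 o1, W o1 o0 & W o2 o2], [&& W o0 o1, W o1 o2 & W o2 o0],
    [&& W o0 o2, W o1 o0 & W o2 o1] | [&& W o0 o2, W o1 o1 & W o2 o0]].
  have D s p q : uniq [:: s; p; q] -> [&& W o0 s, W o1 p & W o2 q] = false.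
    by move=> u; apply/negP=> /and3P[]; apply: (pW o0 o1 o2 s p q).
  by rewrite !D.
have := cross_shape_bool (row o0) (row o1) (row o2) (col o0) (col o1) (col o2) P.
have K i0 s0 : (forall i s, i != i0 -> s != s0 -> ~~ W i s) ->
    exists i0 s0, forall i s, W i s -> i = i0 \/ s = s0.
  move=> H; exists i0, s0 => i s; have [->|ni] := eqVneq i i0; first by left.
  have [->|ns] := eqVneq s s0; first by right.
  by rewrite (negbTE (H _ _ ni ns)).
have vanish (a b c k : bool) : ~~ [|| a, b, c | k] -> [/\ ~~ a, ~~ b, ~~ c & ~~ k].
  by rewrite !negb_or => /and4P[].
case/orP=> [/vanish[? ? ? ?]|]; first by apply: (K o0 o0) => i s; case: (oP i) => ->; case: (oP s) => ->.
case/orP=> [/vanish[? ? ? ?]|]; first by apply: (K o0 o1) => i s; case: (oP i) => ->; case: (oP s) => ->.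
case/orP=> [/vanish[? ? ? ?]|]; first by apply: (K o0 o2) => i s; case: (oP i) => ->; case: (oP s) => ->.
case/orP=> [/vanish[? ? ? ?]|]; first by apply: (K o1 o0) => i s; case: (oP i) => ->; case: (oP s) => ->.
case/orP=> [/vanish[? ? ? ?]|]; first by apply: (K o1 o1) => i s; case: (oP i) => ->; case: (oP s) => ->.
case/orP=> [/vanish[? ? ? ?]|]; first by apply: (K o1 o2) => i s; case: (oP i) => ->; case: (oP s) => ->.
case/orP=> [/vanish[? ? ? ?]|]; first by apply: (K o2 o0) => i s; case: (oP i) => ->; case: (oP s) => ->.
case/orP=> [/vanish[? ? ? ?]|]; first by apply: (K o2 o1) => i s; case: (oP i) => ->; case: (oP s) => ->.
by case/vanish=> ? ? ? ?; apply: (K o2 o2) => i s; case: (oP i) => ->; case: (oP s) => ->.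
Qed.

Section Rainbow.

Variables (I T : finType) (e : I -> rel T).
Hypothesis e_sym : forall i, symmetric (e i).
Implicit Types (G H : {set I * T * T}) (f g h : {ffun T -> T}) (p q r : I * T * T).
Implicit Types (x y z : T) (c : I) (J : {set I}).

Definition rainbow G := (forall p, p \in G -> e p.1.1 p.1.2 p.2) /\
  {in G &, injective (fun p => p.1.1)}.

Definition used G := [set p.1.1 | p in G].

Lemma in_used G p : p \in G -> p.1.1 \in used G.
Proof. exact: (imset_f (fun p => p.1.1)). Qed.

Lemma card_used G : rainbow G -> #|used G| = #|G|.
Proof. by case=> _ injG; rewrite card_in_imset. Qed.

Lemma rainbow_sub G H : G \subset H -> rainbow H -> rainbow G.
Proof.
move=> /subsetP s [H1 H2]; split=> [p /s/H1 //|p q /s pH /s qH].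
exact: H2.
Qed.

Lemma rainbow_add G p : rainbow G -> p.1.1 \notin used G -> e p.1.1 p.1.2 p.2 ->
  rainbow (p |: G).
Proof.
move=> [H1 H2] pG ep; split=> [q /setU1P[->//|/H1 //]|q r].
have N q' : q' \in G -> q'.1.1 <> p.1.1 by move=> qG E; case/negP: pG; rewrite -E in_used.
by case/setU1P=> [->|qG] /setU1P[->|rG] // E; [case: (N _ rG) | case: (N _ qG) | apply: H2].
Qed.

Lemma used_add G p : used (p |: G) = p.1.1 |: used G.
Proof. by rewrite /used imsetU1. Qed.

Definition verts (s : seq (I * T * T)) := flatten [seq [:: p.1.2; p.2] | p <- s].

Definition edges_in J : rel T := [rel x y | [exists i in J, e i x y]].

Lemma edges_in_sym J : symmetric (edges_in J).
Proof. by move=> x y; apply: eq_existsb => i; rewrite e_sym. Qed.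

(** [d] stands for the number of vertices missed by a maximum rainbow matching. More than [t]
    colours contain a larger matching, and one more edge means two missed vertices fewer. *)
Variables (d t : nat).
Hypothesis rainbow_min : forall G, rainbow G -> minfix (adj G) d.
Hypothesis augmenting : forall J, t < #|J| -> exists2 g, mtch (edges_in J) g & nfix g + 2 <= d.

Lemma add_edges (s : seq (I * T * T)) G f : rainbow G -> mtch (adj G) f ->
  all (fun p => e p.1.1 p.1.2 p.2) s -> uniq [seq p.1.1 | p <- s] ->
  (forall p, p \in s -> p.1.1 \notin used G) -> uniq (verts s) ->
  (forall x, x \in verts s -> f x = x) -> d + 2 * size s <= nfix f.
Proof.
elim: s G f => [|p s IH] G f rG mf /=.
  by rewrite muln0 addn0 => _ _ _ _ _; apply: (rainbow_min rG).
move=> /andP[ep es] /andP[pc uc] nu /and3P[]; rewrite inE negb_or => /andP[xy xs] ys uv fv.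
have [fx fy] : f p.1.2 = p.1.2 /\ f p.2 = p.2 by split; apply: fv; rewrite !inE eqxx ?orbT.
have pnu : p.1.1 \notin used G by apply: nu; rewrite mem_head.
have rG' := rainbow_add rG pnu ep.
have ap : adj (p |: G) p.1.2 p.2 by apply: adj_in; apply: setU11.
have mf' : mtch (adj (p |: G)) f by apply: sub_mtch mf; apply/sub_adj/subsetUr.
have ap' : adj (p |: G) p.2 p.1.2 by rewrite adj_sym.
have := IH _ _ rG' (mtch_link mf' ap ap' fx fy) es uc _ uv _.
have <- := nfix_link fx fy xy.
move=> H; rewrite mulnS addnCA add2n !ltnS; apply: H.
  move=> q qs; rewrite used_add !inE negb_or nu ?inE ?qs ?orbT // andbT.
  by apply: contraNneq pc => <-; apply: map_f.
move=> z zs; rewrite ffunE; case: eqP => [E|_]; first by rewrite -E zs in xs.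
by case: eqP => [E|_]; [rewrite -E zs in ys | apply: fv; rewrite !inE zs !orbT].
Qed.

(** * Edges between components of a full rainbow graph *)

Definition cross G c a b := exists x y, [/\ e c x y,
  root (adj G) x = root (adj G) a & root (adj G) y = root (adj G) b].

Lemma cross_sym G c a b : cross G c a b -> cross G c b a.
Proof. by case=> x [y [exy xa yb]]; exists y, x; rewrite e_sym. Qed.

Lemma edge_cross G c x y : e c x y -> cross G c x y.
Proof. by exists x, y. Qed.

(** A full graph can leave any one vertex of each component unmatched, so edges that are disjoint at
    the level of components can be added together, wherever they end inside the components. *)
Lemma cross_bound (s : seq (I * T * T)) G dd : rainbow G -> full (adj G) dd ->
  (forall p, p \in s -> cross G p.1.1 p.1.2 p.2) -> uniq [seq p.1.1 | p <- s] ->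
  (forall p, p \in s -> p.1.1 \notin used G) ->
  uniq [seq root (adj G) x | x <- verts s] -> d + 2 * size s <= dd.
Proof.
move=> rG fG cs uc nu uv.
have [s' [es' cs' vs' ss']] : exists s', [/\ all (fun p => e p.1.1 p.1.2 p.2) s',
    [seq p.1.1 | p <- s'] = [seq p.1.1 | p <- s],
    [seq root (adj G) x | x <- verts s'] = [seq root (adj G) x | x <- verts s]
  & size s' = size s].
  elim: s cs {uc nu uv} => [|p s IH] cs; first by exists [::].
  have [|s' [es' cs' vs' ss']] := IH; first by move=> q qs; apply: cs; rewrite inE qs orbT.
  have [x [y [exy xa yb]]] := cs p (mem_head _ _).
  exists ((p.1.1, x, y) :: s'); split=> /=; rewrite ?exy ?es' ?cs' ?ss' //.
  by rewrite xa yb; do 2!congr cons.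
have uv' : uniq [seq root (adj G) x | x <- verts s'] by rewrite vs'.
have [f [mf nf ff]] := full_select (@adj_sym _ _ G) fG uv'.
rewrite -nf -ss'; apply: (add_edges rG mf es') => //; first by rewrite cs'.
  move=> p ps; have : p.1.1 \in [seq p.1.1 | p <- s'] by apply: map_f.
  by rewrite cs' => /mapP[q qs ->]; apply: nu.
exact: map_uniq uv'.
Qed.

Lemma odd_leaves g (S : {set T}) : involutive g -> odd #|S| ->
  (forall x, x \in S -> g x != x) -> exists2 x, x \in S & g x \notin S.
Proof.
move=> invg oS nf; apply/exists_inP; apply: contraLR oS => /exists_inPn cl.
rewrite (involution_parity invg) => [|x /cl]; last by rewrite negbK.
suff -> : S :&: fixpts g = set0 by rewrite cards0.
by apply/setP=> x; rewrite !inE; apply/negP=> /andP[/nf/negP].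
Qed.

(** Components of a full graph are odd, so a matching that covers one has an edge leaving it. *)
Lemma class_leaves G dd g a J : full (adj G) dd -> mtch (edges_in J) g ->
  (forall x, root (adj G) x = root (adj G) a -> g x != x) ->
  exists x c, [/\ c \in J, e c x (g x), root (adj G) x = root (adj G) a
    & root (adj G) (g x) != root (adj G) a].
Proof.
move=> fG mg nf.
have [x xS gxS] : exists2 x, x \in [set z | root (adj G) z == root (adj G) a]
    & g x \notin [set z | root (adj G) z == root (adj G) a].
  apply: odd_leaves (mtch_inv mg) (class_odd (@adj_sym _ _ G) fG a) _.
  by move=> x; rewrite inE => /eqP/nf.
move: xS gxS; rewrite !inE => /eqP xa gxa.
have /exists_inP[c cJ ec] := mtch_rel mg (nf x xa).
by exists x, c.
Qed.

(** A component is bare if [g] misses none of its vertices; every other component uses up a missed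
    vertex. Bare components are those to which [class_leaves] applies. *)
Lemma card_bare G dd g : full (adj G) dd ->
  dd <= #|root (adj G) @: setT :\: root (adj G) @: fixpts g| + nfix g.
Proof.
move=> fG; rewrite -(card_classes (@adj_sym _ _ G) fG).
apply: leq_trans (leq_add (leqnn _) (leq_imset_card (root (adj G)) (fixpts g))).
by rewrite -cardsUI; apply: leq_trans (leq_addr _ _); apply/subset_leq_card/subsetP=> x xT; rewrite in_setU in_setD xT andbT orNb.
Qed.

Lemma bareP G g z : z \in root (adj G) @: setT :\: root (adj G) @: fixpts g ->
  root (adj G) z = z /\ forall x, root (adj G) x = z -> g x != x.
Proof.
case/setDP=> /imsetP[y _ ->] N; split; first by rewrite root_root //; apply: sym_connect_sym; apply: adj_sym.
by move=> x Ex; move: N; rewrite -Ex; apply: contra => gx; rewrite imset_f // inE.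
Qed.

Lemma full_size G : rainbow G -> full (adj G) d -> #|I| <= #|G| + t.
Proof.
move=> rG fG; rewrite leqNgt; apply/negP=> lt.
have : t < #|~: used G| by have := cardsC (used G); rewrite card_used // => E; move: lt; rewrite -E ltn_add2l.
case/augmenting=> g mg ng.
have := card_bare g fG.
have [->|[z /bareP[rz nz]]] := set_0Vmem (root (adj G) @: setT :\: root (adj G) @: fixpts g).
  by rewrite cards0 add0n => le; have := leq_trans ng le; rewrite -[X in _ <= X]addn0 leq_add2l.
have [|x [c [cJ ec xz gxz]]] := class_leaves (a := z) fG mg; first by rewrite rz.
suff : d + 2 * 1 <= d by rewrite -[X in _ <= X]addn0 leq_add2l.
apply: (@cross_bound [:: (c, x, g x)] G d rG fG) => //=.
- by move=> p; rewrite inE => /eqP->; apply: edge_cross.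
- by move=> p; rewrite inE => /eqP->; rewrite inE in cJ.
- by rewrite inE eq_sym xz gxz.
Qed.

(* The potential: each new colour makes at least one more vertex missable. *)
Lemma grow m G : rainbow G -> (exists2 f, mtch (adj G) f & nfix f = d) ->
  3 * #|T| + 2 * t <= 2 * #|I| + 3 * d ->
  #|~: missable (adj G) d| <= m ->
  2 * #|G| + 2 * #|~: missable (adj G) d| + 3 * d <= 3 * #|T| ->
  exists G', [/\ rainbow G', full (adj G') d & 2 * #|G'| + 3 * d <= 3 * #|T|].
Proof.
have ar (a a' b b' n : nat) : a' < a -> b' <= b.+1 -> 2 * b + 2 * a + 3 * d <= n ->
  2 * b' + 2 * a' + 3 * d <= n by lia.
have ar0 (a b c n k : nat) : 3 * n + 2 * t <= 2 * k + 3 * d -> a + b = k ->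
    2 * a + 2 * c + 3 * d <= 3 * n -> 0 < c -> t < b by lia.
elim: m G => [|m IH] G rG [f mf nf] hI lem leT.
  exists G; split=> //; first split; first exact: rainbow_min.
    by move: lem; rewrite leqn0 cards_eq0 => /eqP E; rewrite -(setCK (missable _ _)) E setC0.
  by apply: leq_trans leT; rewrite leq_add2r leq_addr.
have [E|[v vD]] := set_0Vmem (~: missable (adj G) d).
  exists G; split=> //; first split; first exact: rainbow_min.
    by rewrite -(setCK (missable _ _)) E setC0.
  by apply: leq_trans leT; rewrite leq_add2r leq_addr.
pose J := ~: used G.
have ltJ : t < #|J|.
  have := cardsC (used G); rewrite card_used // -/J => E.
  have : 0 < #|~: missable (adj G) d| by rewrite card_gt0; apply/set0Pn; exists v.
  exact: ar0 hI E leT.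
have [g mg ng] := augmenting ltJ.
case: (boolP [exists x, exists y, [&& edges_in J x y, x != y &
    missable (addedge (adj G) x y) d != missable (adj G) d]]); last first.
  move=> /existsPn H; exfalso.
  have HQ x y : edges_in J x y -> x != y ->
      minfix (addedge (adj G) x y) d /\ missable (addedge (adj G) x y) d = missable (adj G) d.
    move=> Jxy xy; split.
      have /exists_inP[c cJ ec] := Jxy.
      have rG' : rainbow ((c, x, y) |: G) by apply: rainbow_add => //; rewrite -in_setC.
      by apply: sub_minfix (rainbow_min rG') => u w; rewrite adjU1.
    by have /existsPn/(_ y) := H x; rewrite Jxy xy /= negbK => /eqP.
  have mg' : mtch [rel x y | adj G x y || edges_in J x y] g.
    by apply: sub_mtch mg => x y Jxy; apply/orP; right.
  have := enlarge (@adj_sym _ _ G) (@edges_in_sym J) (rainbow_min rG) (ex_intro2 _ _ f mf nf) HQ mg'.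
  move=> H1; have := leq_trans (leq_trans ng H1) (subset_leq_card (subsetIl _ _)).
  by rewrite -/(nfix g) -[X in _ <= X]addn0 leq_add2l.
case/existsP=> x /existsP[y /and3P[/exists_inP[c cJ ec] xy Dxy]].
pose p := (c, x, y); pose G1 := p |: G.
have pnu : p.1.1 \notin used G by rewrite -in_setC.
have E1 : missable (adj G1) d = missable (addedge (adj G) x y) d by apply: eq_missable => u w; exact: adjU1.
have lt1 : #|~: missable (adj G1) d| < #|~: missable (adj G) d|.
  apply: proper_card; rewrite properC properEneq E1 eq_sym Dxy.
  exact/sub_missable/sub_addedge.
have le1 : #|G1| <= #|G|.+1 by rewrite cardsU1; case: (p \notin G).
apply: (IH G1).
- exact: rainbow_add.
- by exists f => //; apply: sub_mtch mf; apply/sub_adj/subsetUr.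
- exact: hI.
- by rewrite -ltnS; apply: leq_trans lt1 lem.
- exact: ar lt1 le1 leT.
Qed.

(** [grow] bounds the number of edges from above, [full_size] from below, and the numerical
    hypothesis makes the bounds meet. Full subgraphs are again rainbow, so [full_size] bounds them
    as well. *)
Lemma exists_tight : 3 * #|T| + 2 * t <= 2 * #|I| + 3 * d ->
  (exists G f, [/\ rainbow G, mtch (adj G) f & nfix f = d]) ->
  exists G, [/\ rainbow G, tight G d & #|I| = #|G| + t].
Proof.
move=> hI [G0 [f [rG0 mf0 nf]]].
have [G [sG mf leG]] := matching_edges mf0; rewrite nf in leG.
have rG := rainbow_sub sG rG0.
have leD : d + #|~: missable (adj G) d| <= #|T|.
  rewrite -(cardsC (missable (adj G) d)) leq_add2r -nf; apply: subset_leq_card.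
  by apply/subsetP=> x; rewrite [_ \in fixpts f]inE => /eqP; apply: in_missable.
have [|G' [rG' fG' leG']] := @grow _ G rG (ex_intro2 _ _ f mf nf) hI (leqnn _).
  have ar1 (a b c N : nat) : 2 * a + b <= N -> b + c <= N -> 2 * a + 2 * c + 3 * b <= 3 * N by lia.
  exact: ar1 leG leD.
have ar (a n k : nat) : 3 * n + 2 * t <= 2 * k + 3 * d -> k <= a + t -> 3 * n <= 2 * a + 3 * d by lia.
have ar2 (a n k : nat) : 3 * n + 2 * t <= 2 * k + 3 * d -> k <= a + t -> 2 * a + 3 * d <= 3 * n ->
   k = a + t by lia.
have sz := full_size rG' fG'.
exists G'; split=> //; last exact: ar2 hI sz leG'.
split=> //; first by apply/eqP; rewrite eqn_leq leG' (ar _ _ _ hI sz).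
move=> H sH fH; apply: ar hI _; apply: full_size fH; exact: rainbow_sub sH rG'.
Qed.

(** * Properly coloured [K_4] on four components *)

Let hit (a b P Q : T) := [|| P == a, P == b, Q == a | Q == b].

Lemma cross_hit G c c' x y a b : rainbow G -> full (adj G) d.+2 -> c != c' ->
  c \notin used G -> c' \notin used G -> cross G c x y -> cross G c' a b ->
  root (adj G) x != root (adj G) y -> root (adj G) a != root (adj G) b ->
  hit (root (adj G) a) (root (adj G) b) (root (adj G) x) (root (adj G) y).
Proof.
move=> rG fG cc' uc uc' cxy cab xy ab; apply/negPn/negP=> N.
suff : d + 2 * 2 <= d.+2 by rewrite -[d.+2]addn2 leq_add2l.
apply: (@cross_bound [:: (c, x, y); (c', a, b)] G _ rG fG) => /=.
- by move=> p; rewrite !inE => /orP[]/eqP->.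
- by rewrite inE cc'.
- by move=> p; rewrite !inE => /orP[]/eqP->.
by move: N; rewrite /hit !inE !negb_or => /and4P[-> -> -> ->]; rewrite xy ab.
Qed.

Lemma ord3_enum (s : 'I_3) : exists i j, uniq [:: s; i; j] /\ forall u, u \in [:: s; i; j].
Proof.
pose o k : 'I_3 := inord k.
have oE k : k < 3 -> val (o k) = k by apply: inordK.
case: s => [[|[|[|]]]] // h; [exists (o 1), (o 2) | exists (o 0), (o 2) | exists (o 0), (o 1)];
  split; try (by rewrite /= !inE -!val_eqE /= ?oE);
  by case=> [[|[|[|]]]] // k; rewrite !inE -!val_eqE /= ?oE.
Qed.

(** An edge that meets all four sides [ab], [bd], [dc], [ca] of a 4-cycle is one of its diagonals
    [ad] and [bc]. The letters [p] and [q] record the corners at which its two ends lie. *)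
Lemma hits_cover (pa pb pc pd qa qb qc qd : bool) :
  [&& ~~ (pa && pb), ~~ (pa && pc), ~~ (pa && pd), ~~ (pb && pc), ~~ (pb && pd) & ~~ (pc && pd)] ->
  [&& ~~ (qa && qb), ~~ (qa && qc), ~~ (qa && qd), ~~ (qb && qc), ~~ (qb && qd) & ~~ (qc && qd)] ->
  [|| pa, pc, qa | qc] -> [|| pb, pd, qb | qd] -> [|| pa, pb, qa | qb] -> [|| pc, pd, qc | qd] ->
  [|| pa && qd, pd && qa, pb && qc | pc && qb].
Proof. by case: pa; case: pb; case: pc; case: pd; case: qa; case: qb; case: qc; case: qd. Qed.

Lemma exclusive (a b c k P : T) : uniq [:: a; b; c; k] ->
  [&& ~~ ((P == a) && (P == b)), ~~ ((P == a) && (P == c)), ~~ ((P == a) && (P == k)),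
      ~~ ((P == b) && (P == c)), ~~ ((P == b) && (P == k)) & ~~ ((P == c) && (P == k))].
Proof.
rewrite /= !inE !negb_or => /and4P[/and3P[ab ac ak] /andP[bc bk] ck _].
have N x y : x != y -> ~~ ((P == x) && (P == y)).
  by apply: contraNN => /andP[/eqP<- /eqP<-].
by rewrite !N.
Qed.

(* Two disjoint edges of distinct unused colours between components would give a
   rainbow matching beyond the maximum, so any two such edges meet; three colours
   forming a triangle then extend to a properly edge-coloured [K_4]. *)
Lemma fourth_class G (K : 'I_3 -> I) (X : 'I_3 -> T) (L := ~: (used G :|: K @: setT)) :
  rainbow G -> full (adj G) d.+2 -> injective K -> (forall s, K s \notin used G) ->
  injective (fun s => root (adj G) (X s)) -> t <= #|L| ->
  (forall s i j, uniq [:: s; i; j] -> cross G (K s) (X i) (X j)) ->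
  exists D, [/\ forall s, root (adj G) (X s) != root (adj G) D,
    forall s, cross G (K s) (X s) D,
    forall s x y, e (K s) x y -> root (adj G) x != root (adj G) y ->
      [\/ root (adj G) x = root (adj G) (X s) /\ root (adj G) y = root (adj G) D,
          root (adj G) x = root (adj G) D /\ root (adj G) y = root (adj G) (X s)
        | exists i j, [/\ uniq [:: s; i; j], root (adj G) x = root (adj G) (X i)
            & root (adj G) y = root (adj G) (X j)]],
    forall c x y, c \in L -> e c x y -> root (adj G) x = root (adj G) y
  & forall s, exists g, [/\ mtch (edges_in (K s |: L)) g,
      forall x s', root (adj G) x = root (adj G) (X s') -> g x != x,
      forall x, root (adj G) x = root (adj G) D -> g x != x
    & forall x y, g x = x -> g y = y -> root (adj G) x = root (adj G) y -> x = y]].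
Proof.
move=> rG fG injK uK injX tL HX; set ro := root (adj G) in injX *.
have KL s : K s \notin L by rewrite in_setC negbK in_setU (imset_f K) ?inE ?orbT.
have uL c : c \in L -> c \notin used G by rewrite in_setC in_setU negb_or => /andP[].
have tJ s : t < #|K s |: L| by rewrite cardsU1 KL ltnS.
have roX i j : i != j -> ro (X i) != ro (X j) by apply: contraNneq => /injX->.
have Kneq i j : i != j -> K i != K j by apply: contraNneq => /injK->.
have uJ s c : c \in K s |: L -> c \notin used G by case/setU1P=> [->|/uL].
have bare4 g : nfix g + 2 <= d -> 3 < #|ro @: setT :\: ro @: fixpts g|.
  have ar (a b : nat) : d.+2 <= a + b -> b + 2 <= d -> 3 < a by lia.
  by move=> ng; apply: ar (card_bare g fG) ng.
(* The matching [g] has at least four bare components, so one besides the three corners. Its edge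
   out of there must meet each triangle edge of another colour, which forces colour [K s] and corner
   [X s]. *)
have step1 s : exists D, (forall i, ro (X i) != ro D) /\ cross G (K s) (X s) D.
  have [g mg ng] := augmenting (tJ s).
  have [z /bareP[rz nz] zX] : exists2 z, z \in ro @: setT :\: ro @: fixpts g & z \notin [set ro (X i) | i : 'I_3].
    apply/exists_inP; rewrite -[X in is_true X]negbK negb_exists_in; apply/negP=> /forall_inP H.
    have : #|ro @: setT :\: ro @: fixpts g| <= #|[set ro (X i) | i : 'I_3]|.
      by apply/subset_leq_card/subsetP=> z /H; rewrite negbK.
    rewrite leqNgt => /negP; apply; apply: leq_ltn_trans (bare4 _ ng).
    by apply: leq_trans (leq_imset_card _ _) _; rewrite card_ord.
  have [|x [c [cJ ec xz gxz]]] := class_leaves (a := z) fG mg; first by rewrite rz.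
  rewrite rz -/ro in xz gxz.
  have Xz i : ro (X i) != z by apply: contraNneq zX => <-; apply: imset_f.
  have [i [j [u _]]] := ord3_enum s.
  have [[si sj] ij] : (s != i /\ s != j) /\ i != j by move: u; rewrite /= !inE negb_or => /and3P[/andP[]].
  have hitX k a b : c != K k -> uniq [:: k; a; b] -> (ro (g x) == ro (X a)) || (ro (g x) == ro (X b)).
    move=> ck ukab; have ab : a != b by move: ukab; rewrite /= !inE => /and3P[].
    have := cross_hit rG fG ck (uJ _ _ cJ) (uK k) (edge_cross G ec) (HX _ _ _ ukab).
    rewrite /hit -/ro xz => /(_ _ (roX _ _ ab)); rewrite ![z == _]eq_sym !(negbTE (Xz _)) /=.
    exact.
  have cL k : k != s -> c != K k.
    move=> ks; case/setU1P: cJ => [->|cL]; first by apply: Kneq; rewrite eq_sym.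
    by apply: contraNneq (KL k) => <-.
  have gX : ro (g x) = ro (X s).
    have : uniq [:: i; s; j] by rewrite /= !inE negb_or (eq_sym i) si ij sj.
    have : uniq [:: j; s; i] by rewrite /= !inE negb_or !(eq_sym j) si ij sj.
    move=> /(hitX j s i (cL _ _)); rewrite eq_sym => /(_ sj)/orP[/eqP //|/eqP gi].
    move=> /(hitX i s j (cL _ _)); rewrite eq_sym => /(_ si)/orP[/eqP //|]; rewrite gi => /eqP/injX E.
    by rewrite E eqxx in ij.
  have cs : c = K s.
    case/setU1P: cJ => // cL'; have ck : c != K s by apply: contraNneq (KL s) => <-.
    by have := hitX s i j ck u; rewrite gX !(negbTE (roX _ _ _)).
  exists x; rewrite xz; split=> //.
  by exists (g x), x; split; [rewrite -cs e_sym | exact: gX | by []].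
(* The components found for two colours agree, since the edges leading to them start at different
   corners and must meet. *)
have [D [XD cD]] : exists D, (forall i, ro (X i) != ro D) /\ forall s, cross G (K s) (X s) D.
  have [D [XD cD]] := step1 ord0; exists D; split=> // s.
  have [->//|s0] := eqVneq s ord0.
  have [D' [XD' cD']] := step1 s.
  have := cross_hit rG fG (Kneq _ _ s0) (uK _) (uK _) cD' cD (XD' _) (XD _).
  rewrite /hit -/ro (negbTE (roX _ _ s0)) (negbTE (XD _)) /= eq_sym (negbTE (XD' _)) /= => /eqP E.
  by have [x [y [exy xa yb]]] := cD'; exists x, y; split=> //; rewrite yb -/ro E.
have uX4 s i j : uniq [:: s; i; j] -> uniq [:: ro (X s); ro (X i); ro (X j); ro D].
  rewrite /= !inE !negb_or => /and3P[/andP[si sj] ij _].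
  by rewrite !XD (roX _ _ si) (roX _ _ sj) (roX _ _ ij).
(* The edges of the other two colours form a 4-cycle in the [K_4], so by [hits_cover] only its
   diagonals remain. *)
have stepA s x y : e (K s) x y -> ro x != ro y ->
      [\/ ro x = ro (X s) /\ ro y = ro D, ro x = ro D /\ ro y = ro (X s)
        | exists i j, [/\ uniq [:: s; i; j], ro x = ro (X i) & ro y = ro (X j)]].
  move=> exy xy; have [i [j [u _]]] := ord3_enum s.
  have [[si sj] ij] : (s != i /\ s != j) /\ i != j by move: u; rewrite /= !inE negb_or => /and3P[/andP[]].
  have uisj : uniq [:: i; s; j] by rewrite /= !inE negb_or (eq_sym i) si ij sj.
  have ujsi : uniq [:: j; s; i] by rewrite /= !inE negb_or !(eq_sym j) si ij sj.
  have h k a b : s != k -> cross G (K k) a b -> ro a != ro b -> hit (ro a) (ro b) (ro x) (ro y).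
    move=> sk cab ab; exact: cross_hit rG fG (Kneq _ _ sk) (uK _) (uK _) (edge_cross G exy) cab xy ab.
  have := hits_cover (exclusive (ro x) (uX4 _ _ _ u)) (exclusive (ro y) (uX4 _ _ _ u))
     (h _ _ _ si (HX _ _ _ uisj) (roX _ _ sj)) (h _ _ _ si (cD i) (XD i))
     (h _ _ _ sj (HX _ _ _ ujsi) (roX _ _ si)) (h _ _ _ sj (cD j) (XD j)).
  case/or4P=> /andP[/eqP E1 /eqP E2].
  - by apply: Or31.
  - by apply: Or32.
  - by apply: Or33; exists i, j.
  - by apply: Or33; exists j, i; split=> //; rewrite /= !inE negb_or si sj eq_sym ij.
(* An edge of a further colour would have to meet all six edges of the [K_4]. *)
have stepL c x y : c \in L -> e c x y -> ro x = ro y.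
  move=> cL exy; apply/eqP/negPn/negP=> xy.
  have [i [j [u _]]] := ord3_enum ord0.
  have [[si sj] ij] : (ord0 != i /\ ord0 != j) /\ i != j by move: u; rewrite /= !inE negb_or => /and3P[/andP[]].
  have uisj : uniq [:: i; ord0; j] by rewrite /= !inE negb_or (eq_sym i) si ij sj.
  have ujsi : uniq [:: j; ord0; i] by rewrite /= !inE negb_or !(eq_sym j) si ij sj.
  have h k a b : cross G (K k) a b -> ro a != ro b -> hit (ro a) (ro b) (ro x) (ro y).
    have ck : c != K k by apply: contraNneq (KL k) => <-.
    move=> cab ab; exact: cross_hit rG fG ck (uL _ cL) (uK _) (edge_cross G exy) cab xy ab.
  have h1 := h _ _ _ (cD ord0) (XD _); have h2 := h _ _ _ (HX _ _ _ u) (roX _ _ ij).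
  have := hits_cover (exclusive (ro x) (uX4 _ _ _ u)) (exclusive (ro y) (uX4 _ _ _ u))
     (h _ _ _ (HX _ _ _ uisj) (roX _ _ sj)) (h _ _ _ (cD i) (XD i))
     (h _ _ _ (HX _ _ _ ujsi) (roX _ _ si)) (h _ _ _ (cD j) (XD j)).
  have nD k : (ro D == ro (X k)) = false by rewrite eq_sym (negbTE (XD k)).
  have n0 k l : k != l -> (ro (X k) == ro (X l)) = false by move=> /roX/negbTE.
  case/or4P=> /andP[/eqP E1 /eqP E2]; move: h1 h2; rewrite /hit E1 E2;
    by rewrite ?nD ?(negbTE (XD _)) ?(n0 _ _ si) ?(n0 _ _ sj) ?(n0 i ord0) ?(n0 j ord0) // eq_sym.
exists D; split=> // s.
have [g mg ng] := augmenting (tJ s).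
(* At least four components are bare and only these four can be, so [g] misses exactly one vertex in
   each of the remaining [d - 2]. *)
pose F := ro D |: [set ro (X i) | i : 'I_3].
have bF : ro @: setT :\: ro @: fixpts g \subset F.
  apply/subsetP=> z /bareP[rz nz].
  have [|x [c [cJ ec xz gxz]]] := class_leaves (a := z) fG mg; first by rewrite rz.
  have gxx : ro x != ro (g x) by rewrite [ro x]xz eq_sym.
  rewrite rz -/ro in xz; rewrite -[z]xz; case/setU1P: cJ => [cs|/stepL/(_ ec) E]; last by rewrite E eqxx in gxx.
  rewrite cs in ec; have [[E _]|[E _]|[i [j [_ E _]]]] := stepA _ _ _ ec gxx; apply/setU1P.
  - by right; rewrite E; apply: imset_f.
  - by left.
  - by right; rewrite E; apply: imset_f.
have F4 : #|F| <= 4.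
  by rewrite cardsU1; apply: (leq_add (leq_b1 _)); apply: leq_trans (leq_imset_card _ _) _; rewrite card_ord.
have EF : ro @: setT :\: ro @: fixpts g = F.
  by apply/eqP; rewrite eqEcard bF (leq_trans F4) // bare4.
have inF x : ro x \in F -> g x != x by rewrite -EF => /bareP[_]; apply.
exists g; split=> //.
- by move=> x s' E; apply: inF; apply/setU1P; right; rewrite E; apply: imset_f.
- by move=> x E; apply: inF; apply/setU1P; left.
have inj : {in fixpts g &, injective ro}.
  apply/imset_injP; rewrite eqn_leq leq_imset_card /=.
  have := card_bare g fG; have := cardsID (ro @: fixpts g) (ro @: setT).
  rewrite (card_classes (@adj_sym _ _ G) fG) -/ro EF (setIidPr _); last by apply: imsetS; apply: subsetT.
  have ar (a b c k n : nat) : k = n -> a + b = d.+2 -> b <= 4 -> n + 2 <= d -> k <= a by lia.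
  by move=> E _; apply: ar (erefl _) E F4 ng.
by move=> x y gx gy; apply: inj; rewrite inE ?gx ?gy.
Qed.

(** * Merging three components along a triangle *)

Lemma uniq3 (a b c : 'I_3) : uniq [:: a; b; c] -> [/\ a != b, a != c & b != c].
Proof. by rewrite /= !inE negb_or => /and3P[/andP[]]. Qed.

Lemma ord3_cover (a b c : 'I_3) : uniq [:: a; b; c] -> forall s, s \in [:: a; b; c].
Proof.
move=> u s; have sub : {subset [:: a; b; c] <= enum 'I_3} by move=> x _; rewrite mem_enum.
have sz : size (enum 'I_3) <= size [:: a; b; c] by rewrite size_enum_ord.
by have [_ ->] := uniq_min_size u sub sz; rewrite mem_enum.
Qed.

Lemma merge_root G H (Y : 'I_3 -> T) (inY := fun u => [exists i, root (adj G) u == root (adj G) (Y i)]) :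
  G \subset H ->
  (forall x y, adj H x y -> adj G x y \/
     exists i j, root (adj G) x = root (adj G) (Y i) /\ root (adj G) y = root (adj G) (Y j)) ->
  (forall i j, root (adj H) (Y i) = root (adj H) (Y j)) ->
  forall u v, (root (adj H) u == root (adj H) v) =
        (root (adj G) u == root (adj G) v) || inY u && inY v.
Proof.
move=> sGH HE HYY; set ro := root (adj G) in inY HE *.
have inYr x a : ro x = ro (Y a) -> inY x by move=> E; apply/existsP; exists a; rewrite -/ro E.
pose P x y := (ro x == ro y) || inY x && inY y.
have PT x y z : P x y -> P y z -> P x z.
  have inYe x' y' : ro x' = ro y' -> inY x' = inY y' by rewrite /inY -/ro => ->.
  rewrite /P; case/orP=> [/eqP E|/andP[xY yY]].
    by rewrite E (inYe _ _ E).
  case/orP=> [/eqP E|/andP[_ ->]]; last by rewrite xY orbT.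
  by rewrite xY -(inYe _ _ E) yY orbT.
have sRH := @adj_sym _ _ H; have sRG := @adj_sym _ _ G.
have PE x y : adj H x y -> P x y.
  case/HE=> [Gxy|[i [j [xi yj]]]]; rewrite /P.
    by rewrite [ro x](root_edge sRG Gxy) eqxx.
  by rewrite (inYr _ _ xi) (inYr _ _ yj) orbT.
have GH x y : ro x = ro y -> root (adj H) x = root (adj H) y.
  exact: root_sub sRG sRH (sub_adj sGH).
move=> x y; apply/eqP/idP; rewrite -/(P x y); last first.
  case/orP=> [/eqP/GH //|/andP[/existsP[a /eqP/GH Ea] /existsP[b /eqP/GH Eb]]].
  by rewrite Ea Eb; apply: HYY.
move=> /(root_eqP x y sRH)/connectP[p]; elim: p x => [|z p IH] x /=.
  by move=> _ ->; rewrite /P eqxx.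
by case/andP=> /PE xz pz yE; apply: PT xz (IH _ pz yE).
Qed.

Lemma merge_triangle G dd (K : 'I_3 -> I) (Y : 'I_3 -> T)
    (inY := fun u => [exists i, root (adj G) u == root (adj G) (Y i)]) :
  rainbow G -> full (adj G) dd.+2 -> injective K -> (forall s, K s \notin used G) ->
  injective (fun s => root (adj G) (Y s)) ->
  (forall s i j, uniq [:: s; i; j] -> cross G (K s) (Y i) (Y j)) ->
  exists H, [/\ rainbow H, full (adj H) dd, used H = used G :|: K @: setT
    & forall u v, (root (adj H) u == root (adj H) v) =
        (root (adj G) u == root (adj G) v) || inY u && inY v].
Proof.
move=> rG fG injK uK injY HY; set ro := root (adj G) in injY inY *.
have [i [j [u cov]]] := ord3_enum ord0; set k := ord0 in u cov.
have [ki kj ij] := uniq3 u.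
have Kneq a b : a != b -> K a != K b by apply: contraNneq => /injK->.
have roY a b : a != b -> ro (Y a) != ro (Y b) by apply: contraNneq => /injY->.
have uki : uniq [:: j; k; i] by rewrite /= !inE negb_or !(eq_sym j) ki kj ij.
have ukj : uniq [:: i; k; j] by rewrite /= !inE negb_or (eq_sym i) ki ij kj.
have [x1 [y1 [e1 xa1 yb1]]] := HY _ _ _ uki.
have [x2 [y2 [e2 xa2 yb2]]] := HY _ _ _ ukj.
have [x3 [y3 [e3 xa3 yb3]]] := HY _ _ _ u.
pose H1 := (K k, x3, y3) |: G; pose H2 := (K i, x2, y2) |: H1; pose H := (K j, x1, y1) |: H2.
have rH1 : rainbow H1 by apply: rainbow_add => //; apply: uK.
have rH2 : rainbow H2.
  by apply: rainbow_add => //; rewrite used_add in_setU1 negb_or uK Kneq // eq_sym.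
have rH : rainbow H.
  apply: rainbow_add => //; rewrite !used_add !in_setU1 !negb_or uK !Kneq // eq_sym //.
have uro : uniq [:: ro (Y k); ro (Y i); ro (Y j)].
  by rewrite /= !inE negb_or (roY _ _ ki) (roY _ _ kj) (roY _ _ ij).
have jn a b x y : ro x = ro a -> ro y = ro b -> joins (adj G) (ro a) (ro b) x y.
  by rewrite /joins -/ro => -> ->; rewrite !eqxx.
have fH : full (adj H) dd by apply: (full_add_triangle fG uro); apply: jn.
have sGH : G \subset H by rewrite /H /H2 /H1 !setUA subsetUr.
exists H; split=> //.
  apply/setP=> c; rewrite /H /H2 /H1 !used_add !in_setU1 in_setU /=.
  apply/or4P/orP=> [[/eqP->|/eqP->|/eqP->|cG]|[cG|/imsetP[a _ ->]]].
  - by right; apply: imset_f.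
  - by right; apply: imset_f.
  - by right; apply: imset_f.
  - by left.
  - exact: Or44.
  - have := cov a; rewrite !inE => /or3P[]/eqP->.
    + by apply: Or43.
    + by apply: Or42.
    + by apply: Or41.
apply: (merge_root (Y := Y) sGH) => [x y|a b].
  have jY x' y' a b : ro x' = ro (Y a) -> ro y' = ro (Y b) ->
      exists i' j', ro x' = ro (Y i') /\ ro y' = ro (Y j') by exists a, b.
  case/adjP=> p; rewrite !in_setU1 => /or4P[/eqP->|/eqP->|/eqP->|pG] E.
  - by right; case: E => -[<- <-]; [apply: jY xa1 yb1 | apply: jY yb1 xa1].
  - by right; case: E => -[<- <-]; [apply: jY xa2 yb2 | apply: jY yb2 xa2].
  - by right; case: E => -[<- <-]; [apply: jY xa3 yb3 | apply: jY yb3 xa3].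
  - by left; apply/adjP; exists p.
have sRH := @adj_sym _ _ H; have sRG := @adj_sym _ _ G.
have GH x y : ro x = ro y -> root (adj H) x = root (adj H) y.
  exact: root_sub sRG sRH (sub_adj sGH).
have HYY a' b' x y : ro x = ro (Y a') -> ro y = ro (Y b') -> adj H x y ->
    root (adj H) (Y a') = root (adj H) (Y b').
  by move=> /GH <- /GH <-; apply: root_edge.
have inH p : p \in H -> adj H p.1.2 p.2 by apply: adj_in.
have HY0 a' : root (adj H) (Y a') = root (adj H) (Y k).
  have := cov a'; rewrite !inE => /or3P[]/eqP-> //; apply/esym.
    by apply: (HYY _ _ _ _ xa1 yb1); apply: (inH (K j, x1, y1)); rewrite !inE eqxx.
  by apply: (HYY _ _ _ _ xa2 yb2); apply: (inH (K i, x2, y2)); rewrite !inE eqxx orbT.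
by rewrite !HY0.
Qed.

(** * Two disjoint triangles on six components *)

Section TwoTriangles.

(* [N true] and [N false] are the corners of two disjoint triangles of components,
   and the edge opposite to [N b s] has colour [K b s]. *)
Variables (G : {set I * T * T}) (N : bool -> 'I_3 -> T) (K : bool -> 'I_3 -> I).
Let ro := root (adj G).
Let L := ~: (used G :|: [set K u.1 u.2 | u : bool * 'I_3]).
Let inN b z := [exists i, ro z == ro (N b i)].

Hypotheses (rG : rainbow G) (fG : full (adj G) d.+4).
Hypothesis injN : injective (fun u : bool * 'I_3 => ro (N u.1 u.2)).
Hypothesis injK : injective (fun u : bool * 'I_3 => K u.1 u.2).
Hypothesis uK : forall b s, K b s \notin used G.
Hypothesis tL : t <= #|L|.
Hypothesis HN : forall b s i j, uniq [:: s; i; j] -> cross G (K b s) (N b i) (N b j).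

Let roN b i b' i' : (ro (N b i) == ro (N b' i')) = ((b, i) == (b', i')).
Proof. exact: (inj_eq injN (b, i) (b', i')). Qed.

Let KE b i b' i' : (K b i == K b' i') = ((b, i) == (b', i')).
Proof. exact: (inj_eq injK (b, i) (b', i')). Qed.

Let inN_N b i b' : inN b (N b' i) = (b == b').
Proof.
apply/existsP/eqP=> [[j]|->]; last by exists i; rewrite eqxx.
by rewrite roN => /eqP[].
Qed.

(** This is [fourth_class] for the other triangle after triangle [b] has been merged. The recurring
    [(ro x == ro y) || inN b x && inN b y] expresses equality of components in the merged graph. *)
Lemma one_side b : exists D, [/\ forall i, ro (N (~~ b) i) != ro D,
    forall s, exists x y, [/\ e (K (~~ b) s) x y, ro x = ro (N (~~ b) s)
       & ro y = ro D \/ inN b y && inN b D],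
    forall s x y, e (K (~~ b) s) x y ->
      [\/ (ro x == ro y) || inN b x && inN b y,
          ro x = ro (N (~~ b) s) /\ ((ro y == ro D) || inN b y && inN b D),
          ((ro x == ro D) || inN b x && inN b D) /\ ro y = ro (N (~~ b) s)
        | exists i j, [/\ uniq [:: s; i; j], ro x = ro (N (~~ b) i) & ro y = ro (N (~~ b) j)]],
    forall c x y, c \in L -> e c x y -> (ro x == ro y) || inN b x && inN b y
  & forall s, exists g, [/\ mtch (edges_in (K (~~ b) s |: L)) g,
      forall x s', ro x = ro (N (~~ b) s') -> g x != x,
      forall x, inN b x -> inN b D -> g x != x
    & forall x y, g x = x -> g y = y -> (ro x == ro y) || inN b x && inN b y -> x = y]].
Proof.
have inj1 b' : injective (K b') by move=> i j E; have /eqP := E; rewrite KE => /eqP[].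
have inj2 b' : injective (fun s => ro (N b' s)) by move=> i j E; have /eqP := E; rewrite roN => /eqP[].
have [H [rH fH uH eH]] := merge_triangle rG fG (@inj1 b) (uK b) (@inj2 b) (@HN b).
rewrite -/ro in eH.
have ENb x i : (root (adj H) x == root (adj H) (N (~~ b) i)) = (ro x == ro (N (~~ b) i)).
  by rewrite eH -/(inN b x) -/(inN b (N (~~ b) i)) inN_N; case: (b); rewrite andbF orbF.
have cH c x y : cross G c x y -> cross H c x y.
  case=> u [v [euv /eqP ux /eqP vy]]; exists u, v; split=> //; apply/eqP; rewrite eH.
    by rewrite [_ == _]ux.
  by rewrite [_ == _]vy.
have EL : ~: (used H :|: K (~~ b) @: setT) = L.
  congr (~: _); rewrite uH -setUA; congr setU; apply/setP=> c; apply/setUP/imsetP.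
    by case=> /imsetP[i _ ->]; [exists (b, i) | exists (~~ b, i)].
  case=> -[b' i] _ ->; have [->|nb] := eqVneq b' b; first by left; apply: imset_f.
  by right; have -> : b' = ~~ b by [case: (b') (b) nb => -[]]; apply: imset_f.
have uKH s : K (~~ b) s \notin used H.
  rewrite uH in_setU negb_or uK /=; apply/imsetP=> -[i _ /eqP].
  by rewrite KE => /eqP[]; case: (b).
have injH : injective (fun s => root (adj H) (N (~~ b) s)).
  by move=> i j /eqP; rewrite ENb => /eqP/inj2.
have tLH : t <= #|~: (used H :|: K (~~ b) @: setT)| by rewrite EL.
have [D [D1 D2 D3 D4 D5]] := fourth_class rH fH (@inj1 (~~ b)) uKH injH tLH
  (fun s i j u => cH _ _ _ (@HN (~~ b) s i j u)).
rewrite EL in D4 D5.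
have eHr x y : (root (adj H) x == root (adj H) y) = (ro x == ro y) || inN b x && inN b y by exact: eH.
have ENb' x i : root (adj H) x = root (adj H) (N (~~ b) i) -> ro x = ro (N (~~ b) i).
  by move/eqP; rewrite ENb => /eqP.
exists D; split.
- by move=> i; have := D1 i; rewrite eq_sym ENb eq_sym.
- move=> s; have [x [y [exy /ENb' xa /eqP]]] := D2 s.
  by rewrite eHr => /orP[/eqP yD|yD]; exists x, y; split=> //; [left | right].
- move=> s x y exy; have [E|E] := boolP (root (adj H) x == root (adj H) y).
    by apply: Or41; rewrite -eHr.
  have [[E1 E2]|[E1 E2]|[i [j [u E1 E2]]]] := D3 _ _ _ exy E.
  + by apply: Or42; split; [apply: ENb' | rewrite -eHr E2].
  + by apply: Or43; split; [rewrite -eHr E1 | apply: ENb'].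
  + by apply: Or44; exists i, j; split=> //; apply: ENb'.
- by move=> c x y cL exy; rewrite -eHr (D4 _ _ _ cL exy).
- move=> s; have [g [mg g1 g2 g3]] := D5 s; exists g; split=> //.
  + move=> x s' E; apply: (g1 x s'); apply/eqP; rewrite ENb E; exact: eqxx.
  + by move=> x xb Db; apply: g2; apply/eqP; rewrite eHr xb Db orbT.
  + by move=> x y gx gy E; apply: g3 => //; apply/eqP; rewrite eHr.
Qed.

Lemma no_three c1 x1 y1 c2 x2 y2 c3 x3 y3 : uniq [:: c1; c2; c3] ->
  [/\ c1 \notin used G, c2 \notin used G & c3 \notin used G] ->
  cross G c1 x1 y1 -> cross G c2 x2 y2 -> cross G c3 x3 y3 ->
  uniq [:: ro x1; ro y1; ro x2; ro y2; ro x3; ro y3] -> False.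
Proof.
move=> uc [u1 u2 u3] k1 k2 k3 uv.
suff : d + 2 * 3 <= d.+4 by rewrite -[d.+4]addn4 leq_add2l.
apply: (@cross_bound [:: (c1, x1, y1); (c2, x2, y2); (c3, x3, y3)] G _ rG fG) => //=.
- by move=> p; rewrite !inE => /or3P[]/eqP->.
- by move=> p; rewrite !inE => /or3P[]/eqP->.
Qed.

Let Nd (u : bool * 'I_3) := N u.1 u.2.
Let Kd (u : bool * 'I_3) := K u.1 u.2.

Lemma no_three_nodes (c1 u1 v1 c2 u2 v2 c3 u3 v3 : bool * 'I_3) : uniq [:: c1; c2; c3] ->
  uniq [:: u1; v1; u2; v2; u3; v3] ->
  cross G (Kd c1) (Nd u1) (Nd v1) -> cross G (Kd c2) (Nd u2) (Nd v2) ->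
  cross G (Kd c3) (Nd u3) (Nd v3) -> False.
Proof.
move=> uc uv k1 k2 k3; apply: no_three k1 k2 k3 _.
- by rewrite -(map_inj_uniq injK) in uc.
- by split; apply: uK.
- by rewrite -(map_inj_uniq injN) in uv.
Qed.

Lemma third (i j : 'I_3) : i != j -> exists l, uniq [:: l; i; j].
Proof.
move=> ij; have [a [b [u cov]]] := ord3_enum i.
have [ia ib ab] := uniq3 u; have := cov j; rewrite !inE (eq_sym j) (negbTE ij) /=.
case/orP=> /eqP->; [exists b | exists a]; rewrite /= !inE negb_or ?ia ?ib ?ab !andbT.
  by rewrite !(eq_sym b) ib.
by rewrite (eq_sym a) ia.
Qed.

Let unusedL c : c \in L -> c \notin used G.
Proof. by rewrite in_setC in_setU negb_or => /andP[]. Qed.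

Let neqL c b s : c \in L -> c != K b s.
Proof.
rewrite in_setC in_setU negb_or => /andP[_]; apply: contraNneq => ->.
by apply/imsetP; exists (b, s).
Qed.

Let inNr b x y : ro x = ro y -> inN b x = inN b y.
Proof. by rewrite /inN => ->. Qed.

Let inN_disj b x : inN b x -> inN (~~ b) x = false.
Proof.
by case/existsP=> i /eqP E; rewrite (inNr _ E) inN_N; case: (b).
Qed.

(* If the fourth class of one triangle is not the merged other triangle, an edge
   inside that other triangle can be recoloured, freeing one of its colours. *)
Lemma fourth_is_merged b D :
  (forall i, ro (N (~~ b) i) != ro D) ->
  (forall s, exists x y, [/\ e (K (~~ b) s) x y, ro x = ro (N (~~ b) s)
       & ro y = ro D \/ inN b y && inN b D]) ->
  (forall s x y, e (K (~~ b) s) x y ->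
      [\/ (ro x == ro y) || inN b x && inN b y,
          ro x = ro (N (~~ b) s) /\ ((ro y == ro D) || inN b y && inN b D),
          ((ro x == ro D) || inN b x && inN b D) /\ ro y = ro (N (~~ b) s)
        | exists i j, [/\ uniq [:: s; i; j], ro x = ro (N (~~ b) i) & ro y = ro (N (~~ b) j)]]) ->
  (forall c x y, c \in L -> e c x y -> (ro x == ro y) || inN b x && inN b y) ->
  (forall s, exists g, [/\ mtch (edges_in (K (~~ b) s |: L)) g,
      forall x s', ro x = ro (N (~~ b) s') -> g x != x,
      forall x, inN b x -> inN b D -> g x != x
    & forall x y, g x = x -> g y = y -> (ro x == ro y) || inN b x && inN b y -> x = y]) ->
  inN b D.
Proof.
move=> D1 D2 D3 D4 D5; case: (boolP (inN b D)) => [//|ND]; exfalso.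
have [s1 [s2 [us _]]] := ord3_enum ord0; have [s01 s02 s12] := uniq3 us.
have [g [mg _ _ g3]] := D5 ord0.
(* [g] misses at most one vertex in the whole of triangle [b], so some corner is covered completely.
   The edge leaving that corner stays inside the triangle, since [D] lies outside. *)
have [i nfi] : exists i, forall x, ro x = ro (N b i) -> g x != x.
  have [/existsP[x /andP[/eqP gx /eqP xi]]|/existsPn H] :=
      boolP [exists x, (g x == x) && (ro x == ro (N b ord0))]; last first.
    by exists ord0 => x xi; have := H x; rewrite xi eqxx andbT.
  exists s1 => y yi; apply/eqP=> gy.
  have E : x = y.
    by apply: g3 => //; rewrite (inNr _ xi) (inNr _ yi) !inN_N eqxx orbT.
  by have := roN b ord0 b s1; rewrite -xi -yi E eqxx => /esym/eqP[] /eqP; rewrite (negbTE s01).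
have [x [c [cJ ec xi gxi]]] := class_leaves (a := N b i) fG mg nfi.
rewrite -/ro in xi gxi.
have xgx : (ro x == ro (g x)) = false by rewrite xi eq_sym (negbTE gxi).
have xb : inN b x by rewrite (inNr _ xi) inN_N.
have xnb : forall k, ro x <> ro (N (~~ b) k).
  by move=> k /eqP; rewrite xi roN => /eqP[]; case: (b).
have uc : c \notin used G by case/setU1P: cJ => [->|/unusedL].
have gxb : inN b (g x).
  case/setU1P: cJ => [cE|/D4/(_ ec)]; last by rewrite xgx xb.
  rewrite cE in ec; case: (D3 _ _ _ ec).
  - by rewrite xgx xb.
  - by case=> /xnb.
  - case=> /orP[/eqP xD|/andP[_ Db]]; last by rewrite Db in ND.
    by move: ND; rewrite -(inNr _ xD) xb.
  - by case=> k [k' [_ /xnb]].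
have /existsP[j /eqP gj] := gxb.
have ij : i != j by apply: contraNneq gxi => ->; rewrite gj.
(* Corners [i] and [j] are now joined in colour [c], which frees [K b l] to join corner [l] to a
   component outside the triangle. *)
have [l ul] := third ij; have [li lj _] := uniq3 ul.
have [D' [D1' D2' _ _ _]] := one_side (~~ b).
rewrite !negbK in D1' D2'.
have [x' [y' [ec' xl' yD']]] := D2' l.
have yb : inN b y' = false.
  case: yD' => [E|/andP[yb _]]; last by have := inN_disj yb; rewrite negbK.
  by apply/existsP=> -[k]; rewrite E eq_sym (negbTE (D1' k)).
have yN k : (ro y' == ro (N b k)) = false.
  by apply/negP=> yk; suff : inN b y' by [rewrite yb]; apply/existsP; exists k.
have [x2 [y2 [ec2 x2s y2D]]] := D2 s1.
have {y2D} y2D : ro y2 = ro D by case: y2D => // /andP[_ Db]; rewrite Db in ND.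
have DN k : (ro D == ro (N b k)) = false.
  by apply/negP=> Dk; suff : inN b D by [rewrite (negbTE ND)]; apply/existsP; exists k.
have cc : uniq [:: c; K b l; K (~~ b) s1].
  have bl s s' : K b s != K (~~ b) s' by rewrite KE xpair_eqE; case: (b).
  rewrite /= !inE !negb_or bl !andbT; case/setU1P: cJ => [->|cL]; last by rewrite !neqL.
  by rewrite eq_sym bl /= KE xpair_eqE eqxx (negbTE s01).
have us' : [/\ c \notin used G, K b l \notin used G & K (~~ b) s1 \notin used G] by split.
have rNN k k' : (ro (N b k) == ro (N (~~ b) k')) = false by rewrite roN xpair_eqE; case: (b).
have NbE k k' : (ro (N b k) == ro (N b k')) = (k == k') by rewrite roN xpair_eqE eqxx.
have NnbE k k' : (ro (N (~~ b) k) == ro (N (~~ b) k')) = (k == k') by rewrite roN xpair_eqE eqxx.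
have uA : uniq [:: s1; ord0; s2] by rewrite /= !inE negb_or (eq_sym s1) s01 s12 s02.
have k1 := edge_cross G ec; have k2 := edge_cross G ec'.
have base A1 A2 : cross G (K (~~ b) s1) A1 A2 ->
    [&& ro y' != ro A1, ro y' != ro A2, ro A1 != ro A2 & [forall k, (ro (N b k) != ro A1) && (ro (N b k) != ro A2)]] -> False.
  move=> kA /and4P[yA1 yA2 A12 /forallP nA].
  apply: (no_three cc us' k1 k2 kA); rewrite xi gj xl'.
  have [a1 a2] := andP (nA i); have [a3 a4] := andP (nA j); have [a5 a6] := andP (nA l).
  rewrite /= !inE !negb_or !NbE ij (eq_sym i) li (eq_sym j) lj a1 a2 a3 a4 a5 a6 yA1 yA2 A12.
  by rewrite !(eq_sym _ (ro y')) !yN.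
(* The third edge, of colour [K (~~ b) s1], has to avoid [y']: it is the one from corner [s1] to
   [D], or else the triangle edge opposite to that corner. *)
have [yS|nyS] := boolP ((ro y' == ro (N (~~ b) ord0)) || (ro y' == ro (N (~~ b) s2))).
  apply: (base x2 y2 (edge_cross G ec2)); rewrite x2s y2D.
  rewrite D1 /=; apply/and3P; split.
  - by case/orP: yS => /eqP->; rewrite NnbE ?(eq_sym s2) ?s01 ?s12.
  - by case/orP: yS => /eqP->; apply: D1.
  - by apply/forallP=> k; rewrite rNN eq_sym DN.
move: nyS; rewrite negb_or => /andP[y0 y2'].
apply: (base _ _ (@HN (~~ b) s1 ord0 s2 uA)); rewrite y0 y2' NnbE s02 /=.
by apply/forallP=> k; rewrite !rNN.
Qed.

(** Otherwise the edge would lie inside both triangles, which are disjoint. *)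
Let L_within c x y : c \in L -> e c x y -> ro x = ro y.
Proof.
move=> cL exy.
have [D1 [_ _ _ H1 _]] := one_side true; have [D2 [_ _ _ H2 _]] := one_side false.
case/orP: (H1 _ _ _ cL exy) => [/eqP //|/andP[xt _]].
case/orP: (H2 _ _ _ cL exy) => [/eqP //|/andP[xf _]].
by have := inN_disj xt; rewrite /= xf.
Qed.

(** The fourth class is triangle [b] itself, so the matching in the colours [K (~~ b) s] and [L]
    covers each corner of it and has an edge leaving that corner; by [L_within] its colour is
    [K (~~ b) s]. *)
Let merged_side b : (forall s, exists i, cross G (K (~~ b) s) (N (~~ b) s) (N b i)) /\
  (forall s i, cross G (K (~~ b) s) (N b i) (N (~~ b) s) \/
     exists2 i', i' != i & cross G (K (~~ b) s) (N b i) (N b i')).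
Proof.
have [D [D1 D2 D3 D4 D5]] := one_side b.
have Db := fourth_is_merged D1 D2 D3 D4 D5.
split=> s.
  have [x [y [exy xs yD]]] := D2 s.
  have /existsP[i /eqP yi] : inN b y by case: yD => [/(inNr b)->|/andP[]].
  by exists i, x, y.
move=> i; have [g [mg _ g2 _]] := D5 s.
have nf x : ro x = ro (N b i) -> g x != x.
  by move=> xi; apply: g2 => //; rewrite (inNr _ xi) inN_N.
have [x [c [cJ ec xi gxi]]] := class_leaves fG mg nf.
rewrite -/ro in xi gxi.
have xgx : (ro x == ro (g x)) = false by rewrite xi eq_sym (negbTE gxi).
case/setU1P: cJ => [cE|/L_within/(_ ec)/eqP]; last by rewrite xgx.
have xnb : forall k, ro x <> ro (N (~~ b) k).
  by move=> k /eqP; rewrite xi roN => /eqP[]; case: (b).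
rewrite cE in ec; case: (D3 _ _ _ ec).
- rewrite xgx => /andP[_ /existsP[i' /eqP gi]]; right; exists i'.
    by apply: contraNneq gxi => <-; rewrite gi.
  by exists x, (g x).
- by case=> /xnb.
- by case=> _ gs; left; exists x, (g x).
- by case=> k [k' [_ /xnb]].
Qed.

Let side_cross b s : exists i, cross G (K b s) (N b s) (N (~~ b) i).
Proof. by have [] := merged_side (~~ b); rewrite negbK. Qed.

Let side_node b s i : cross G (K b s) (N (~~ b) i) (N b s) \/
  exists2 i', i' != i & cross G (K b s) (N (~~ b) i) (N (~~ b) i').
Proof. by have [_] := merged_side (~~ b); rewrite negbK. Qed.

Local Ltac distinct_pairs :=
  rewrite /= !inE !xpair_eqE /= ?eqxx /= ?negb_or ?orbF ?andbT; repeat (apply/andP; split); by [].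

(** By [side_node], colour [K (~~ b) i] joins [p] to [q] or to [s0]. In the latter case, the edge
    [q]-[i0] of colour [K b q] and the triangle edge [i]-[i'] of colour [K (~~ b) i0] would complete
    a rainbow perfect matching on six components. *)
Let wing b (i0 i i' s0 p q : 'I_3) : uniq [:: i0; i; i'] -> uniq [:: s0; p; q] ->
  cross G (K b q) (N b q) (N (~~ b) i0) ->
  ~ cross G (K (~~ b) i) (N (~~ b) i) (N b p) ->
  cross G (K (~~ b) i) (N b p) (N b q).
Proof.
move=> ui us kq nip; have [i0i i0i' ii'] := uniq3 ui; have [s0p s0q pq] := uniq3 us.
have := side_node (~~ b) i p; rewrite negbK => -[/cross_sym //|[s' s'p ks']].
have [E|s'q] := eqVneq s' q; first by rewrite -E.
have E : s' = s0.
  by have := ord3_cover us s'; rewrite !inE (negbTE s'p) (negbTE s'q) !orbF => /eqP.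
exfalso; rewrite E in ks'.
have := @no_three_nodes (~~ b, i) (b, p) (b, s0) (b, q) (b, q) (~~ b, i0) (~~ b, i0) (~~ b, i) (~~ b, i').
apply=> //; last exact: (HN (~~ b) ui).
  by clear kq nip ks'; rewrite eq_sym in i0i; case: (b); distinct_pairs.
clear kq nip ks'; rewrite eq_sym in s0p.
by case: (b); distinct_pairs.
Qed.

Lemma two_triangles_false : False.
Proof.
(* [W] records the edges between the triangles whose colour belongs to one of their own two corners.
   A permutation inside [W] thus has three distinct colours and contradicts [no_three_nodes], so
   [cross_shape] applies. *)
pose W i s := [exists x, exists y, e (K true s) x y && (ro x == ro (N true s)) && (ro y == ro (N false i))]
  || [exists x, exists y, e (K false i) x y && (ro x == ro (N false i)) && (ro y == ro (N true s))].
have W1 i s : cross G (K true s) (N true s) (N false i) -> W i s.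
  case=> x [y [exy xs yi]]; apply/orP; left; apply/existsP; exists x; apply/existsP; exists y.
  by rewrite exy /ro xs yi !eqxx.
have W2 i s : cross G (K false i) (N false i) (N true s) -> W i s.
  case=> x [y [exy xs yi]]; apply/orP; right; apply/existsP; exists x; apply/existsP; exists y.
  by rewrite exy /ro xs yi !eqxx.
have WE i s : W i s -> exists b, cross G (Kd (b, if b then s else i)) (N true s) (N false i).
  case/orP=> /existsP[x /existsP[y /andP[/andP[exy /eqP xs] /eqP yi]]].
    by exists true, x, y.
  by exists false; apply: cross_sym; exists x, y.
have [i0 [s0 HW]] : exists i0 s0, forall i s, W i s -> i = i0 \/ s = s0.
  apply: cross_shape.
  - by move=> i; have [s /W2] := side_cross false i; exists s.
  - by move=> s; have [i /W1] := side_cross true s; exists i.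
  - move=> i j l s p q ui us /WE[b1 k1] /WE[b2 k2] /WE[b3 k3].
    have [ij il jl] := uniq3 ui; have [sp sq pq] := uniq3 us.
    apply: (@no_three_nodes _ (true, s) (false, i) _ (true, p) (false, j) _ (true, q) (false, l) _ _ k1 k2 k3).
      by clear k1 k2 k3; case: b1; case: b2; case: b3; distinct_pairs.
    by clear k1 k2 k3; distinct_pairs.
have row i : i != i0 -> cross G (K false i) (N false i) (N true s0).
  move=> ni; have [s ks] := side_cross false i; case: (HW _ _ (W2 _ _ ks)) => E; first by rewrite E eqxx in ni.
  by rewrite -E.
have col s : s != s0 -> cross G (K true s) (N true s) (N false i0).
  move=> ns; have [i ki] := side_cross true s; case: (HW _ _ (W1 _ _ ki)) => E; last by rewrite E eqxx in ns.
  by rewrite -E.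
have [j [l [ui covi]]] := ord3_enum i0; have [i0j i0l jl] := uniq3 ui.
have [p [q [us covs]]] := ord3_enum s0; have [s0p s0q pq] := uniq3 us.
have noW i s : i != i0 -> s != s0 -> ~ cross G (K false i) (N false i) (N true s).
  by move=> ni ns /W2/HW[] E; rewrite E eqxx in ni ns.
have noW' i s : i != i0 -> s != s0 -> ~ cross G (K true s) (N true s) (N false i).
  by move=> ni ns /W1/HW[] E; rewrite E eqxx in ni ns.
have ui' : uniq [:: i0; l; j] by rewrite /= !inE negb_or i0j i0l eq_sym jl.
have [ji0 li0] : j != i0 /\ l != i0 by rewrite !(eq_sym _ i0).
have [ps0 qs0] : p != s0 /\ q != s0 by rewrite !(eq_sym _ s0).
have wj : cross G (K false j) (N true p) (N true q).
  exact: (@wing true _ _ _ _ _ _ ui us (col _ qs0) (noW _ _ ji0 ps0)).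
have wl : cross G (K false l) (N true p) (N true q).
  exact: (@wing true _ _ _ _ _ _ ui' us (col _ qs0) (noW _ _ li0 ps0)).
have wp : cross G (K true p) (N false j) (N false l).
  exact: (@wing false _ _ _ _ _ _ us ui (row _ li0) (noW' _ _ ji0 ps0)).
have [lj qp] : l != j /\ q != p by rewrite eq_sym jl eq_sym pq.
(* An edge at [(i0, s0)] would be completed by the wings [p]-[q] and [j]-[l]. *)
have nW0 : ~ W i0 s0.
  case/WE=> b k; apply: (@no_three_nodes _ (true, s0) (false, i0) (false, j) (true, p) (true, q)
    (true, p) (false, j) (false, l) _ _ k wj wp); last by clear - i0j i0l jl s0p s0q pq; distinct_pairs.
  by clear - i0j s0p ji0 ps0; case: b; distinct_pairs.
(* The edge of colour [K true s0] at its own corner therefore ends at some [i] other than [i0]. It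
   is completed by [i0]-[i'] in colour [K false i] and the wing [p]-[q] in colour [K false i']. *)
have [i ki] := side_cross true s0.
have ni : i != i0 by apply/eqP=> E; apply: nW0; rewrite -E; apply: W1.
have [i' [uii wi']] : exists i', uniq [:: i; i0; i'] /\ cross G (K false i') (N true p) (N true q).
  have := covi i; rewrite !inE (negbTE ni) /= => /orP[]/eqP->; [exists l | exists j]; split=> //.
    by rewrite /= !inE negb_or ji0 jl i0l.
  by rewrite /= !inE negb_or li0 lj i0j.
have [_ ii' i0i'] := uniq3 uii.
apply: (@no_three_nodes (true, s0) (true, s0) (false, i) (false, i) (false, i0) (false, i')
  (false, i') (true, p) (true, q) _ _ ki (HN false uii) wi').
  by clear - ii'; distinct_pairs.
by clear - s0p s0q pq ni ii' i0i'; distinct_pairs.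
Qed.

End TwoTriangles.

(** * Contradiction from a tight rainbow graph *)

Lemma triangle_family G G0 p q r A B C : rainbow G -> G0 \subset G ->
  [/\ p \in G :\: G0, q \in G :\: G0, r \in G :\: G0 & uniq [:: p; q; r]] ->
  uniq [:: root (adj G0) A; root (adj G0) B; root (adj G0) C] ->
  [/\ joins (adj G0) (root (adj G0) A) (root (adj G0) B) p.1.2 p.2,
      joins (adj G0) (root (adj G0) A) (root (adj G0) C) q.1.2 q.2
    & joins (adj G0) (root (adj G0) B) (root (adj G0) C) r.1.2 r.2] ->
  #|G| = #|G0| + 3 ->
  exists (K : 'I_3 -> I) (X : 'I_3 -> T),
    [/\ injective K, forall s, K s \notin used G0, injective (fun s => root (adj G0) (X s)),
        forall s i j, uniq [:: s; i; j] -> cross G0 (K s) (X i) (X j)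
      & used G = used G0 :|: K @: setT /\ forall u v, (root (adj G) u == root (adj G) v) =
        (root (adj G0) u == root (adj G0) v) ||
        [exists i, root (adj G0) u == root (adj G0) (X i)] && [exists i, root (adj G0) v == root (adj G0) (X i)]].
Proof.
move=> [H1 H2] sG [/setDP[pG pG0] /setDP[qG qG0] /setDP[rG rG0] upqr] uABC [jp jq jr] cG.
set ro := root (adj G0) in uABC jp jq jr *.
have [pq pr qr] : [/\ p != q, p != r & q != r].
  by move: upqr; rewrite /= !inE negb_or => /and3P[/andP[]].
have [AB AC BC] : [/\ ro A != ro B, ro A != ro C & ro B != ro C].
  by move: uABC; rewrite /= !inE negb_or => /and3P[/andP[]].
pose o k (h : k < 3) : 'I_3 := Ordinal h.
(* The reversed order makes [K s] the colour of the edge opposite to [X s]. *)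
pose K (s : 'I_3) := nth p.1.1 [:: r.1.1; q.1.1; p.1.1] s.
pose X (s : 'I_3) := nth A [:: A; B; C] s.
have neqc u v : u \in G -> v \in G -> u != v -> u.1.1 != v.1.1.
  by move=> uG vG; apply: contraNneq => /(H2 _ _ uG vG)->.
have nu u : u \in G -> u \notin G0 -> u.1.1 \notin used G0.
  move=> uG; apply: contraNN => /imsetP[v vG0 E].
  by rewrite (H2 _ _ uG (subsetP sG _ vG0) E).
have EG : G = p |: (q |: (r |: G0)).
  apply/esym/eqP; rewrite eqEcard !subUset !sub1set pG qG rG sG /= cG.
  by rewrite !cardsU1 !in_setU1 !negb_or pq pr qr pG0 qG0 rG0 addn3.
have ord (s : 'I_3) : [\/ s = o 0 isT, s = o 1 isT | s = o 2 isT].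
  by case: s => [[|[|[|]]]] // h; [apply: Or31 | apply: Or32 | apply: Or33]; apply: val_inj.
have jc u a b : u \in G -> joins (adj G0) (ro a) (ro b) u.1.2 u.2 -> cross G0 u.1.1 a b.
  move=> uG /orP[]/andP[/eqP E1 /eqP E2]; first by exists u.1.2, u.2; split=> //; apply: H1.
  by apply: cross_sym; exists u.1.2, u.2; split=> //; apply: H1.
exists K, X; split.
- move=> s s'; case: (ord s) => ->; case: (ord s') => -> //=; rewrite /K /=;
    by move/eqP; rewrite ?(negbTE (neqc _ _ pG qG pq)) ?(negbTE (neqc _ _ pG rG pr))
      ?(negbTE (neqc _ _ qG rG qr)) // eq_sym ?(negbTE (neqc _ _ pG qG pq)) ?(negbTE (neqc _ _ pG rG pr))
      ?(negbTE (neqc _ _ qG rG qr)).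
- by move=> s; case: (ord s) => ->; apply: nu.
- move=> s s'; case: (ord s) => ->; case: (ord s') => -> //=; rewrite /X /= -/ro;
    by move/eqP; rewrite ?(negbTE AB) ?(negbTE AC) ?(negbTE BC) // eq_sym ?(negbTE AB) ?(negbTE AC) ?(negbTE BC).
- move=> s i j; case: (ord s) => ->; case: (ord i) => ->; case: (ord j) => -> // _;
    by [apply: jc | apply: cross_sym; apply: jc].
split.
  apply/setP=> c; rewrite EG !used_add !in_setU1 in_setU.
  apply/or4P/orP=> [[/eqP->|/eqP->|/eqP->|cG0]|[cG0|/imsetP[s _ ->]]].
  - by right; apply/imsetP; exists (o 2 isT).
  - by right; apply/imsetP; exists (o 1 isT).
  - by right; apply/imsetP; exists (o 0 isT).
  - by left.
  - exact: Or44.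
  - by case: (ord s) => ->; [apply: Or43 | apply: Or42 | apply: Or41].
have sRG := @adj_sym _ _ G; have sR0 := @adj_sym _ _ G0.
have jY a b x y : joins (adj G0) (ro (X a)) (ro (X b)) x y ->
    exists i j, ro x = ro (X i) /\ ro y = ro (X j).
  by case/orP=> /andP[/eqP E1 /eqP E2]; [exists a, b | exists b, a].
apply: (merge_root (Y := X) sG) => [x y|].
  case/adjP=> u; rewrite {1}EG !in_setU1 => /or4P[/eqP->|/eqP->|/eqP->|uG] E.
  - by right; apply: (@jY (o 0 isT) (o 1 isT)); case: E => -[<- <-] //; rewrite joins_swap.
  - by right; apply: (@jY (o 0 isT) (o 2 isT)); case: E => -[<- <-] //; rewrite joins_swap.
  - by right; apply: (@jY (o 1 isT) (o 2 isT)); case: E => -[<- <-] //; rewrite joins_swap.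
  - by left; apply/adjP; exists u.
have up x y : ro x = ro y -> root (adj G) x = root (adj G) y.
  exact: root_sub sR0 sRG (sub_adj sG).
have jr' u a b : u \in G -> joins (adj G0) (ro a) (ro b) u.1.2 u.2 -> root (adj G) a = root (adj G) b.
  move=> uG; have E := root_edge sRG (adj_in uG).
  by case/orP=> /andP[/eqP/up E1 /eqP/up E2]; rewrite -E1 -E2.
have E1 := jr' _ _ _ pG jp; have E2 := jr' _ _ _ qG jq.
by move=> i j; case: (ord i) => ->; case: (ord j) => ->; rewrite /X /= -?E1 -?E2.
Qed.

(** Each decomposition raises [d] by two, so the bound [d + 4] allows two of them in succession. *)
Lemma not_tight G : rainbow G -> tight G d -> #|I| = #|G| + t -> d + 4 <= #|T| -> False.
Proof.
have ar1 (n a b k : nat) : 2 * a + 3 * k = 3 * n -> 2 * b + 3 * k.+2 = 3 * n -> a = b + 3 by lia.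
have ar2 (k n : nat) : k + 4 <= n -> k < n /\ k.+2 < n by lia.
have ar3 (a b u l i : nat) : i = a + t -> a = b + 3 -> u <= b + 3 -> u + l = i -> t <= l by lia.
move=> rG tG cI dT; have [d1 d2] := ar2 _ _ dT.
have [G0 [p [q [r [A [B [C [sG0 tG0 Hp uABC Hj]]]]]]]] := decompose tG d1.
have [G1 [p' [q' [r' [A' [B' [C' [sG1 tG1 Hp' uABC' Hj']]]]]]]] := decompose tG0 d2.
have [[_ cG _] [fG0 cG0 _] [fG1 cG1 _]] := And3 tG tG0 tG1.
have sz0 := ar1 _ _ _ _ cG cG0; have sz1 := ar1 _ _ _ _ cG0 cG1.
have rG0 := rainbow_sub sG0 rG; have rG1 := rainbow_sub sG1 rG0.
have [K [X [injK uK injX HX [usedG _]]]] := triangle_family rG sG0 Hp uABC Hj sz0.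
have [K' [Y [injK' uK' injY HY [usedG0 eqG0]]]] := triangle_family rG0 sG1 Hp' uABC' Hj' sz1.
have tL : t <= #|~: (used G0 :|: K @: setT)|.
  apply: ar3 cI sz0 _ (cardsC _).
  rewrite cardsU; apply: leq_trans (leq_subr _ _) _; rewrite card_used // leq_add2l.
  by apply: leq_trans (leq_imset_card _ _) _; rewrite cardsT card_ord.
have [D [D1 D2 _ _ _]] := fourth_class rG0 fG0 injK uK injX tL HX.
set r1 := root (adj G1) in injY eqG0 HY *; set r0 := root (adj G0) in injX eqG0 D1.
pose inY u := [exists i, r1 u == r1 (Y i)].
have rY i : inY (Y i) by apply/existsP; exists i.
(* If corner [s] of triangle [X] is the component merged from [Y], it is replaced by [D]. The edge
   from [D] to [X i] has colour [K i] and is opposite to [X j] in the new triangle, whence the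
   transposition of [i] and [j]. *)
have [K2 [X2 [injK2 K2K injX2 HX2 nX2]]] : exists (K2 : 'I_3 -> I) (X2 : 'I_3 -> T),
    [/\ injective K2, K2 @: setT = K @: setT, injective (fun s => r0 (X2 s)),
      forall s i j, uniq [:: s; i; j] -> cross G0 (K2 s) (X2 i) (X2 j)
    & forall i, ~~ inY (X2 i)].
  have [/existsP[s Xs]|/existsPn nX] := boolP [exists s, inY (X s)]; last by exists K, X.
  have [i [j [u cov]]] := ord3_enum s; have [si sj ij] := uniq3 u.
  pose K2 := K \o tperm i j; pose X2 k := if k == s then D else X k.
  have roX a b : a != b -> r0 (X a) != r0 (X b) by apply: contraNneq => /injX->.
  have nX k : k != s -> ~~ inY (X k).
    move=> ks; apply/negP=> Xk; have := roX _ _ ks.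
    by rewrite eqG0 -/(inY (X k)) -/(inY (X s)) Xk Xs orbT.
  exists K2, X2; split.
  - by apply: inj_comp injK _; apply: perm_inj.
  - apply/setP=> c; apply/imsetP/imsetP=> -[a _ ->]; exists (tperm i j a) => //.
    by rewrite /K2 /= tpermK.
  - move=> a b; rewrite /X2; case: (eqVneq a s) => [->|_]; case: (eqVneq b s) => [->|_] //.
    + by move/eqP; rewrite eq_sym (negbTE (D1 _)).
    + by move/eqP; rewrite (negbTE (D1 _)).
    + exact: injX.
  - have tsi : tperm i j s = s by rewrite tpermD // eq_sym.
    have cij := HX _ _ _ u; have cDi := D2 i; have cDj := D2 j.
    move=> a b c uabc; have [ab ac bc] := uniq3 uabc; rewrite /K2 /X2 /=.
    have := cov a; have := cov b; have := cov c; rewrite !inE.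
    move=> /or3P[]/eqP Ec /or3P[]/eqP Eb /or3P[]/eqP Ea; subst a b c;
      rewrite ?eqxx ?tsi ?tpermL ?tpermR ?(negbTE si) ?(negbTE sj) ?(eq_sym i s) ?(eq_sym j s) ?(negbTE si) ?(negbTE sj);
      by [rewrite eqxx in ab | rewrite eqxx in ac | rewrite eqxx in bc | assumption | apply: cross_sym].
  - move=> k; rewrite /X2; case: eqVneq => [_|/nX //].
    apply/negP=> DY; have := D1 s; rewrite eqG0 -/(inY (X s)) -/(inY D) Xs.
    by rewrite DY orbT.
have r01 x y : r1 x = r1 y -> r0 x = r0 y.
  by move=> E; apply/eqP; rewrite eqG0 E eqxx.
have r10 x i : r0 x = r0 (X2 i) -> r1 x = r1 (X2 i).
  move/eqP; rewrite eqG0 -/(inY x) -/(inY (X2 i)) (negbTE (nX2 i)) andbF orbF; exact/eqP.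
pose NN (b : bool) := if b then X2 else Y.
pose KK (b : bool) := if b then K2 else K'.
have K2u s : K2 s \notin used G0.
  have : K2 s \in K @: setT by rewrite -K2K imset_f.
  by case/imsetP=> s' _ ->.
have K2n s s' : K2 s != K' s'.
  apply: contraNneq (K2u s) => ->; rewrite usedG0 in_setU; apply/orP; right; exact: imset_f.
have X2n s s' : r1 (X2 s) != r1 (Y s').
  by apply: contraNneq (nX2 s) => E; apply/existsP; exists s'; rewrite E.
apply: (@two_triangles_false G1 NN KK) => //.
- move=> [[] i] [[] j] /= E.
  + by rewrite (injX2 i j) //; apply: r01.
  + by have := X2n i j; rewrite -/r1 in E; rewrite E eqxx.
  + by have := X2n j i; rewrite -/r1 in E; rewrite E eqxx.
  + by rewrite (injY i j).
- move=> [[] i] [[] j] /= E.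
  + by rewrite (injK2 i j).
  + by have := K2n i j; rewrite E eqxx.
  + by have := K2n j i; rewrite E eqxx.
  + by rewrite (injK' i j).
- case=> s /=; last exact: uK'.
  by apply: contraNN (K2u s) => sG; rewrite usedG0 in_setU sG.
- apply: leq_trans tL _; apply: subset_leq_card; rewrite setCS usedG0 -K2K -setUA; apply: setUS.
  apply/subsetP=> c /imsetP[[[] i] _ ->]; apply/setUP; [right | left]; exact: imset_f.
- case=> s i j u; last exact: HY.
  have [x [y [exy xi yj]]] := HX2 _ _ _ u.
  by exists x, y; split=> //; apply: r10.
Qed.

End Rainbow.

Lemma rainbow_finite (I T : finType) (e : I -> rel T) n t : (forall i, symmetric (e i)) -> 2 < n ->
  #|I| = 3 * n - 3 + t ->
  (forall J : {set I}, #|J| = t.+1 ->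
     exists2 g : {ffun T -> T}, mtch (edges_in e J) g & nfix g + 2 * n <= #|T|) ->
  exists G (f : {ffun T -> T}), [/\ rainbow e G, mtch (adj G) f & nfix f + 2 * n <= #|T|].
Proof.
have ar1 (a m : nat) : m < a + 2 * n -> odd a = odd m -> m + 2 <= a + 2 * n by lia.
have ar2 (a b m : nat) : a + 2 * n <= m -> m + 2 <= b + 2 * n -> a + 2 <= b by lia.
have ar3 (b k m : nat) : 2 < n -> m + 2 <= b + 2 * n -> k = 3 * n - 3 + t ->
  3 * m + 2 * t <= 2 * k + 3 * b by lia.
(* Here [a = 3n - 3] edges, so [m - b = 2n - 2], which is at least 4 for [n >= 3]. *)
have ar4 (a b k m : nat) : 2 < n -> k = 3 * n - 3 + t -> k = a + t -> 2 * a + 3 * b = 3 * m ->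
  b + 4 <= m by lia.
move=> e_sym n3 cI aug.
pose rb (G : {set I * T * T}) := [forall p in G, e p.1.1 p.1.2 p.2] &&
  [forall p in G, forall q in G, (p.1.1 == q.1.1) ==> (p == q)].
have rbP (G : {set I * T * T}) : reflect (rainbow e G) (rb G).
  apply: (iffP andP) => [[/forall_inP H1 /forall_inP H2]|[H1 H2]].
    split=> // p q pG qG E; have /forall_inP/(_ q qG) := H2 p pG.
    by rewrite E eqxx => /eqP.
  split; first exact/forall_inP.
  apply/forall_inP=> p pG; apply/forall_inP=> q qG; apply/implyP=> /eqP E.
  by apply/eqP; apply: H2.
pose P m := [exists G : {set I * T * T}, exists f : {ffun T -> T}, [&& rb G, mtch (adj G) f & nfix f == m]].
have exP : exists m, P m.
  exists (nfix [ffun x : T => x]); apply/existsP; exists set0; apply/existsP; exists [ffun x => x].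
  rewrite eqxx andbT; apply/andP; split.
    by apply/rbP; split=> [p|p q]; rewrite inE.
  by apply/mtchP; split=> x; rewrite !ffunE ?eqxx.
case: (ex_minnP exP) => d /existsP[G /existsP[f /and3P[/rbP rG mf /eqP nf]]] dmin.
have [le|lt] := leqP (nfix f + 2 * n) #|T|; first by exists G, f.
exfalso; rewrite nf in lt.
(* [#|T| - d] is even, so a strict shortfall is one of at least two vertices. *)
have le2 : #|T| + 2 <= d + 2 * n.
  by apply: ar1 lt _; rewrite -nf (nfix_parity (mtch_inv mf)).
have rmin (H : {set I * T * T}) : rainbow e H -> minfix (adj H) d.
  move=> rH g mg; apply: dmin; apply/existsP; exists H; apply/existsP; exists g.
  by rewrite mg eqxx !andbT; apply/rbP.
have augment (J : {set I}) : t < #|J| -> exists2 g, mtch (edges_in e J) g & nfix g + 2 <= d.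
  move=> tJ; have [J' sJ' cJ'] : exists2 J' : {set I}, J' \subset J & #|J'| = t.+1.
    have [s [us sJ cs]] : exists s, [/\ uniq s, {subset s <= J} & size s = t.+1].
      exists (take t.+1 (enum J)); split; first by rewrite take_uniq // enum_uniq.
        by move=> c /mem_take; rewrite mem_enum.
      by rewrite size_takel // -cardE.
    exists [set c in s]; first by apply/subsetP=> c; rewrite inE => /sJ.
    by rewrite -cs -(card_uniqP us) cardsE.
  have [g mg ng] := aug J' cJ'; exists g; last exact: ar2 ng le2.
  apply: sub_mtch mg => x y /exists_inP[c cJ ec]; apply/exists_inP; exists c => //.
  exact: (subsetP sJ').
have [|H [rH tH cH]] := exists_tight e_sym rmin augment (ar3 _ _ _ n3 le2 cI).
  by exists G, f.
have [_ eH _] := tH.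
by apply: (not_tight e_sym rmin augment rH tH cH); apply: ar4 n3 cI cH eH.
Qed.

From mathcomp Require Import finmap.
From mathcomp Require Import boolp classical_sets.

Local Open Scope classical_set_scope.

(** * From simple graphs to finite graphs *)

Section Transfer.

Variables (G : sgraph) (N : nat) (E : 'I_N -> set {fset G}) (V : {fset G}).

Definition color_adj (i : 'I_N) : rel V := fun x y => `[< E i [fset val x; val y]%fset >].

Lemma color_adj_sym i : symmetric (color_adj i).
Proof. by move=> x y; rewrite /color_adj fsetUC. Qed.

Lemma matching_involution (J : {set 'I_N}) (M : {fset {fset G}}) n :
  matching M -> #|` M|%fset = n -> [set` M] `<=` \bigcup_(i in [set` J]) E i ->
  (forall e, e \in M -> (e `<=` V)%fset) ->
  exists2 g : {ffun V -> V}, mtch (edges_in color_adj J) g & nfix g + 2 * n <= #|{: V}|.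
Proof.
move=> [MG Mdisj] cM MJ MV.
have Meq e1 e2 v : e1 \in M -> e2 \in M -> v \in e1 -> v \in e2 -> e1 = e2.
  move=> h1 h2 v1 v2; apply/eqP/negPn/negP=> /(Mdisj _ _ h1 h2)/fdisjointP/(_ v v1).
  by rewrite v2.
pose mate (x y : V) := (y != x) && ([fset val x; val y]%fset \in M).
pose g : {ffun V -> V} := [ffun x => odflt x [pick y | mate x y]].
have mateC x y : mate x y = mate y x by rewrite /mate eq_sym fsetUC.
have mate_uniq x y z : mate x y -> mate x z -> y = z.
  move=> /andP[yx yM] /andP[zx zM]; apply: val_inj.
  have E1 := Meq _ _ (val x) yM zM (fset21 _ _) (fset21 _ _).
  have := fset22 (val x) (val y); rewrite E1 => /fset2P[e|//].
  by rewrite -(val_inj e) eqxx in yx.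
have gmate x y : mate x y -> g x = y.
  by move=> xy; rewrite ffunE; case: pickP => [z /(mate_uniq _ _ _ xy)|/(_ y)] //=; rewrite xy.
have gP x : g x != x -> mate x (g x).
  by rewrite ffunE; case: pickP => [y //|_] /=; rewrite eqxx.
have mg : mtch (edges_in color_adj J) g.
  apply/mtchP; split=> x.
    by have [e|/gP] := eqVneq (g x) x; [rewrite !e | rewrite mateC => /gmate].
  case/gP/andP=> _ /MJ[i /= iJ Ei]; apply/exists_inP; exists i => //; exact/asboolP.
exists g => //.
have /fin_all_exists[p Hp] (e : M) : exists p : V * V, p.1 != p.2 /\ val e = [fset val p.1; val p.2]%fset.
  have [u [w [auw Ee]]] := MG _ (valP e).
  have uV : u \in V by apply: (fsubsetP (MV _ (valP e))); rewrite Ee fset21.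
  have wV : w \in V by apply: (fsubsetP (MV _ (valP e))); rewrite Ee fset22.
  exists ([` uV]%fset, [` wV]%fset); split=> //=.
  by apply/eqP=> /(congr1 val) /= uw; apply: (@adj_irrefl G u); rewrite {2}uw.
(* The boolean selects an end of the edge, so [h] produces two matched vertices for every edge of
   [M]. *)
pose h (eb : M * bool) := if eb.2 then (p eb.1).1 else (p eb.1).2.
have hin eb : val (h eb) \in val eb.1.
  by have [_ ->] := Hp eb.1; rewrite /h; case: eb.2; rewrite ?fset21 ?fset22.
have hinj : injective h.
  move=> [e b] [e' b'] E1.
  have ee : e = e'.
    by apply: val_inj; apply: Meq (valP e) (valP e') (hin (e, b)) _; rewrite E1; apply: hin (e', b').
  move: E1; rewrite -ee /h /=; have [pe _] := Hp e.
  case: b; case: b' => // E1; first by rewrite E1 eqxx in pe.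
  by rewrite E1 eqxx in pe.
have hfix eb : h eb \notin fixpts g.
  have [pe Ee] := Hp eb.1; have m12 : mate (p eb.1).1 (p eb.1).2 by rewrite /mate eq_sym pe -Ee; apply: valP.
  rewrite inE /h; case: eb.2; first by rewrite (gmate _ _ m12) eq_sym.
  by rewrite mateC in m12; rewrite (gmate _ _ m12).
have : #|codom h| <= #|~: fixpts g|.
  by apply/subset_leq_card/fintype.subsetP=> _ /codomP[eb ->]; rewrite inE hfix.
rewrite card_codom // card_prod card_bool -(cardfE M) cM mulnC => le.
by rewrite -(cardsC (fixpts g)) leq_add2l.
Qed.

Lemma rainbow_matching_of_finite (H : {set 'I_N * V * V}) (f : {ffun V -> V}) n :
  (forall i, E i `<=` @edges G) -> rainbow color_adj H -> mtch (adj H) f ->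
  nfix f + 2 * n <= #|{: V}| -> has_rainbow_matching E n.
Proof.
move=> hE [H1 H2] mf nf; have invf := mtch_inv mf.
have len : n <= #|lower f|.
  by move: nf; rewrite -(card_lower invf) addnC leq_add2r leq_mul2l.
pose x (j : 'I_n) : V := enum_val (widen_ord len j).
have xl j : x j \in lower f by apply: enum_valP.
have xinj i j : x i = x j -> i = j by move=> /enum_val_inj/(congr1 val)/= /val_inj.
have fx j : f (x j) != x j by apply: contraTneq (xl j) => e; rewrite inE e ltnn.
have xfx i j : x i <> f (x j).
  move=> e; have := xl i; rewrite e inE invf => /ltnW; rewrite leqNgt.
  by have := xl j; rewrite inE => ->.
have /fin_all_exists[p Hp] (j : 'I_n) : exists p : 'I_N * V * V, p \in H /\
    ((p.1.2, p.2) = (x j, f (x j)) \/ (p.1.2, p.2) = (f (x j), x j)).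
  by have /adjP[q qH Eq] := mtch_rel mf (fx j); exists q.
pose F j := [fset val (x j); val (f (x j))]%fset.
have EF j : E (p j).1.1 (F j).
  have [pH Eq] := Hp j; have /asboolP := H1 _ pH.
  by case: Eq => -[-> ->] //; rewrite fsetUC.
have share i j v : v \in F i -> v \in F j -> i = j.
  move=> /fset2P[]-> /fset2P[]/val_inj e.
  - exact: xinj.
  - by case: (xfx i j).
  - by case: (xfx j i).
  - by apply: xinj; apply: (inv_inj invf).
have Finj i j : F i = F j -> i = j.
  by move=> e; apply: (share i j (val (x i))); rewrite -?e fset21.
exists (fun j => (p j).1.1), F; split=> //.
- move=> i j e; have [pi Ei] := Hp i; have [pj Ej] := Hp j.
  have pp : p i = p j by apply: H2.
  rewrite pp in Ei; have : x i = x j \/ x i = f (x j).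
    by case: Ei Ej => -[a1 a2] [] [b1 b2]; [left | right | right | left]; congruence.
  by case=> [/xinj|/xfx].
- split=> [e /= /imfsetP[j _ ->]|e e' /imfsetP[i _ ->] /imfsetP[j _ ->] ne]; first exact: hE (EF j).
  apply/fdisjointP=> v vi; apply/negP=> vj; move/eqP: ne; apply.
  by rewrite (share i j v vi vj).
- rewrite card_imfset //; exact: size_enum_ord.
Qed.

End Transfer.

Theorem theorem4p3 (t n : nat) (hn : 3 <= n) (G : sgraph)
    (E : 'I_(3 * n - 3 + t) -> set {fset G})
    (hE : forall i, E i `<=` @edges G)
    (hmatch : forall J : {set 'I_(3 * n - 3 + t)}, #|J| = t.+1 ->
       has_matching (\bigcup_(i in [set` J]) E i) n) :
  has_rainbow_matching E n.
Proof.
have /fin_all_exists[M HM] (J : {set 'I_(3 * n - 3 + t)}) : exists M : {fset {fset G}}, #|J| = t.+1 ->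
    [/\ matching M, #|` M|%fset = n & [set` M] `<=` \bigcup_(i in [set` J]) E i].
  have [/hmatch[M HM]|ne] := eqVneq #|J| t.+1; first by exists M.
  by exists fset0 => e; rewrite e eqxx in ne.
(* [G] may be infinite, but a finite [V] containing one matching of size [n] for each set of [t + 1]
   indices suffices. *)
pose V := (\bigcup_(J <- enum {set 'I_(3 * n - 3 + t)}) \bigcup_(e <- M J) e)%fset.
have [|J cJ|H [f [rH mf nf]]] := @rainbow_finite _ V (color_adj E (V := V)) n t (color_adj_sym E (V := V)) hn.
- by rewrite card_ord.
- have [MG cM MJ] := HM J cJ; apply: matching_involution MG cM MJ _ => e eM.
  apply/fsubsetP=> v ve; apply/bigfcupP; exists J; rewrite ?mem_enum //.
  by apply/bigfcupP; exists e; rewrite ?eM.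
exact: rainbow_matching_of_finite hE rH mf nf.
Qed.
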